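(* Let $X_n=(\mathbb{C}^n,\|\cdot\|)$ be a Banach lattice and let $J\subset\mathbb{N}_0^n$ be an index set of degree at most $m$. Then $$\boldsymbol{\chi_{\mathrm{mon}}}\big(\mathcal{P}_J(X_n)\big)\le e(m+1)2^m\max_{1\le k\le m}\|\mathbf{Q}_{\Lambda(k,n),J(k)}\|\,\max_{1\le k\le m}\boldsymbol{\lambda}\big(\mathcal{P}_{J(k)^\flat}(X_n)\big).$$ In addition, if $J\subset\Lambda(m,n)$, then $$\boldsymbol{\chi_{\mathrm{mon}}}\big(\mathcal{P}_J(X_n)\big)\le e2^m\|\mathbf{Q}_{\Lambda(m,n),J}\|\,\boldsymbol{\lambda}\big(\mathcal{P}_{J^\flat}(X_n)\big).$$
   Context: A Banach lattice $X_n=(\mathbb{C}^n,\|\cdot\|)$ is a norm on $\mathbb{C}^n$ with $\|z\|\le\|w\|$ whenever $|z_k|\le|w_k|$ for all $k$. $\Lambda(k,n)=\{\alpha\in\mathbb{N}_0^n:|\alpha|=k\}$; $J(k)=J\cap\Lambda(k,n)$; $J$ has degree at most $m$ if $|\alpha|\le m$ for all $\alpha\in J$. For $J\subset\Lambda(m,n)$, $J^\flat=\{\alpha\in\Lambda(m-1,n):\alpha+e_k\in J\text{ for some }k\}$. $\mathcal{P}_J(X_n)$: polynomials $\sum_{\alpha\in J}c_\alpha z^\alpha$ with sup norm over the open unit ball of $X_n$. For $I\subset J'$, $\mathbf{Q}_{J',I}:\mathcal{P}_{J'}(X_n)\to\mathcal{P}_I(X_n)$ keeps the coefficients indexed by $I$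 and annihilates the others. $\boldsymbol{\lambda}$: projection constant. $\boldsymbol{\chi_{\mathrm{mon}}}(\mathcal{P}_J(X_n))$: least $K$ with $\|\sum\varepsilon_\alpha c_\alpha z^\alpha\|\le K\|\sum c_\alpha z^\alpha\|$ for all scalars and all $|\varepsilon_\alpha|=1$.
   Formalization: The formal theorem assumes m ≥ 1 and that J is not {0}: for J = {0} the left side is 1 while every J(k), k ≥ 1, is empty so the right side is 0, and for m = 0 the maxima and the set J^♭ are undefined. *)

(* Defs.v *)
From HB Require Import structures.
From mathcomp Require Import all_boot all_order all_algebra.
From mathcomp Require Import all_classical all_reals.
From mathcomp.analysis Require Import ereal sequences exp.
From mathcomp.real_closed Require Import complex.

Set Implicit Arguments.
Unset Strict Implicit.
Unset Printing Implicit Defensive.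

Import Order.TTheory GRing.Theory Num.Theory.
Local Open Scope ring_scope.
Local Open Scope classical_set_scope.

Definition cmod (R : realType) (z : R[i]) : R :=
  let: Complex a b := z in Num.sqrt (a ^+ 2 + b ^+ 2).

(** Banach lattice norm on C^n (vectors are functions 'I_n -> C).
    Finite dimensional, hence automatically complete. *)
Definition is_lattice_norm (R : realType) (n : nat)
  (N : ('I_n -> R[i]) -> R) : Prop :=
  [/\ (forall z, N z = 0 -> z = (fun _ => 0)),
      (forall (a : R[i]) z, N (fun k => a * z k) = cmod a * N z),
      (forall z w, N (fun k => z k + w k) <= N z + N w)
    & (forall z w, (forall k, cmod (z k) <= cmod (w k)) -> N z <= N w)].

(** multi-indices in N_0^n with all entries <= m (every multi-index of
    degree <= m is of this form) *)
Definition mi (n m : nat) := {ffun 'I_n -> 'I_m.+1}.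

Definition deg n m (a : mi n m) : nat := \sum_(i < n) (a i : nat).

Definition Lambda n m (k : nat) : {set mi n m} := [set a | deg a == k].

Definition Jk n m (J : {set mi n m}) (k : nat) : {set mi n m} :=
  J :&: Lambda n m k.

Definition plus_e n m (b : mi n m) (i : 'I_n) (a : mi n m) : bool :=
  [forall j, (a j : nat) == (b j + (j == i))%N].

Definition flat n m (k : nat) (I : {set mi n m}) : {set mi n m} :=
  [set b | (deg b == k.-1) && [exists a in I, exists i, plus_e b i a]].

(** polynomials are given by their coefficient families *)
Definition monom (R : realType) n m (z : 'I_n -> R[i]) (a : mi n m) : R[i] :=
  \prod_(i < n) z i ^+ a i.

Definition peval (R : realType) n m (c : mi n m -> R[i]) (z : 'I_n -> R[i])
  : R[i] := \sum_(a : mi n m) c a * monom z a.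

(** c is the coefficient family of an element of P_I(X_n) *)
Definition supported (R : realType) n m (I : {set mi n m})
  (c : mi n m -> R[i]) : Prop := forall a, a \notin I -> c a = 0.

Definition ball_ (R : realType) n (N : ('I_n -> R[i]) -> R)
  : set ('I_n -> R[i]) := [set z | N z < 1].

Definition pnorm (R : realType) n m (N : ('I_n -> R[i]) -> R)
  (c : mi n m -> R[i]) : \bar R :=
  ereal_sup [set (cmod (peval c z))%:E | z in ball_ N].

Definition chi_mon (R : realType) n m (N : ('I_n -> R[i]) -> R)
  (J : {set mi n m}) : \bar R :=
  ereal_inf [set K%:E | K in [set K : R | 0 <= K /\
    forall c, supported J c ->
    forall eps : mi n m -> R[i], (forall a, cmod (eps a) = 1) ->
      (pnorm N (fun a => (eps a * c a)%R) <= K%:E * pnorm N c)%E]].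

Definition Qproj (R : realType) n m (I : {set mi n m}) (c : mi n m -> R[i])
  : mi n m -> R[i] := fun a => if a \in I then c a else 0.

Definition Qnorm (R : realType) n m (N : ('I_n -> R[i]) -> R)
  (I' I : {set mi n m}) : \bar R :=
  ereal_sup [set pnorm N (Qproj I c) | c in
    [set c | supported I' c /\ (pnorm N c <= 1%E)%E]].

Definition is_norm (R : realType) (Z : lmodType R[i]) (nZ : Z -> R) : Prop :=
  [/\ (forall x, nZ x = 0 -> x = 0),
      (forall (a : R[i]) x, nZ (a *: x) = cmod a * nZ x)
    & (forall x y, nZ (x + y) <= nZ x + nZ y)].

(** relative projection constant lambda(Y, Z) where Y = P_I(X_n) is
    isometrically embedded into (Z, nZ) by j:
    inf of the norms of the projections P : Z -> Y onto j(Y) *)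
Definition rel_proj_const (R : realType) n m (N : ('I_n -> R[i]) -> R)
  (I : {set mi n m}) (Z : lmodType R[i]) (nZ : Z -> R)
  (j : (mi n m -> R[i]) -> Z) : \bar R :=
  ereal_inf [set opn | exists P : Z -> (mi n m -> R[i]),
    [/\ (forall (s : R[i]) x y a, P (s *: x + y) a = s * P x a + P y a),
        (forall x, supported I (P x)),
        (forall c, supported I c -> P (j c) = c)
      & opn = ereal_sup [set pnorm N (P x) | x in [set x | nZ x <= 1]]]].

Definition proj_const (R : realType) n m (N : ('I_n -> R[i]) -> R)
  (I : {set mi n m}) : \bar R :=
  ereal_sup [set l | exists (Z : lmodType R[i]) (nZ : Z -> R)
      (j : (mi n m -> R[i]) -> Z),
    [/\ is_norm nZ,
        (forall (s : R[i]) c d, supported I c -> supported I d ->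
            j (fun a => s * c a + d a) = s *: j c + j d),
        (forall c, supported I c -> (nZ (j c))%:E = pnorm N c)
      & l = rel_proj_const N I nZ j]].

(* Main.v *)
Require Import Defs.
From HB Require Import structures.
From mathcomp Require Import all_boot all_order all_algebra.
From mathcomp Require Import all_classical all_reals.
From mathcomp.analysis Require Import ereal sequences exp.
From mathcomp.real_closed Require Import complex.
From mathcomp Require Import cyclic separable cyclotomic ring lra zify.

(** Let P be homogeneous of degree k with coefficients c supported by I, and z in the unit ball.
    Differentiating, k * sum_a |c_a z^a| = sum_i |z_i| sum_b |d_ib z^b| with d_ib the
    coefficients of the i-th partial derivative of P, which is supported by the flat of I.
    Sampling on a finite net (pt t) of the ball embeds the space of the flat almost isometrically
    in an l_infty space, so that a projection of norm l onto it gives polynomials Pi_t with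
    sum_t |Pi_t| <= l on the ball (up to a factor close to 1) and sum_t (pt t)^b Pi_tb = 1.
    Inserting this identity and applying Cauchy-Schwarz to sum_b |d_ib (pt t)^b| |Pi_tb z^b|
    separates the two factors: Weissler's inequality bounds the square function of a polynomial
    with weights 2^-|b| by its mean on the torus, which costs 2^(k-1).  The means of the
    derivatives add up to at most e k ||P|| by Cauchy's estimate, and those of the Pi_t to l.

    Weissler's inequality reduces by Minkowski to one variable.  There, reflecting the zeros of f
    out of the disc gives f = g^2 up to a small error, and the coefficients of g^2 satisfy
    |(g^2)_k|^2 <= (k+1) sum_j |g_j|^2 |g_(k-j)|^2 with k+1 <= 2^k.  All means are
    averages over roots of unity, on a set fixed in advance by a summation kernel. *)

Set Implicit Arguments.
Unset Strict Implicit.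
Unset Printing Implicit Defensive.

Import Order.TTheory GRing.Theory Num.Theory.
Local Open Scope complex_scope.
Local Open Scope ring_scope.

(** * Arithmetic of the complex modulus *)

Section Modulus.
Context {R : realType}.
Implicit Types z w : R[i].

Lemma cmod_ge0 z : 0 <= cmod z.
Proof. by case: z => a b; exact: sqrtr_ge0. Qed.

Lemma cmodM z w : cmod (z * w) = cmod z * cmod w.
Proof. exact: Normc.normcM. Qed.

Lemma cmod0 : cmod (0 : R[i]) = 0.
Proof. exact: Normc.normc0. Qed.

Lemma cmod1 : cmod (1 : R[i]) = 1.
Proof. exact: Normc.normc1. Qed.

Lemma cmod0_eq0 z : cmod z = 0 -> z = 0.
Proof. exact: Normc.eq0_normc. Qed.

Lemma cmodV z : cmod z^-1 = (cmod z)^-1.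
Proof. exact: Normc.normcV. Qed.

Lemma ler_cmodD z w : cmod (z + w) <= cmod z + cmod w.
Proof. exact: le_normcD. Qed.

Lemma cmodN z : cmod (- z) = cmod z.
Proof. exact: normcN. Qed.

Lemma ler_cmodB z w : cmod (z - w) <= cmod z + cmod w.
Proof. by rewrite -(cmodN w) ler_cmodD. Qed.

Lemma cmod_real (x : R) : 0 <= x -> cmod x%:C = x.
Proof. by move=> x0; rewrite /cmod /= expr0n addr0 sqrtr_sqr ger0_norm. Qed.

Lemma cmodX z k : cmod (z ^+ k) = cmod z ^+ k.
Proof. by elim: k => [|k IH]; rewrite ?cmod1 // !exprS cmodM IH. Qed.

Lemma cmod_conj z : cmod (conjc z) = cmod z.
Proof. by case: z => a b; rewrite /cmod /= sqrrN. Qed.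

Lemma cmod_sqr z : (cmod z ^+ 2)%:C = z * conjc z.
Proof.
case: z => a b; rewrite /cmod sqr_sqrtr ?addr_ge0 ?sqr_ge0 //.
by apply/eqP; rewrite eq_complex /=; apply/andP; split; apply/eqP; ring.
Qed.

Lemma ler_cmod_sum (I : Type) (r : seq I) (P : pred I) (F : I -> R[i]) :
  cmod (\sum_(i <- r | P i) F i) <= \sum_(i <- r | P i) cmod (F i).
Proof.
elim/big_ind2: _ => [|z x w y zx wy|//]; first by rewrite cmod0.
exact: le_trans (ler_cmodD _ _) (lerD zx wy).
Qed.

Lemma cmod_prod (I : Type) (r : seq I) (P : pred I) (F : I -> R[i]) :
  cmod (\prod_(i <- r | P i) F i) = \prod_(i <- r | P i) cmod (F i).
Proof. exact: (big_morph _ cmodM cmod1). Qed.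

(** Supplies the phases that later turn a sum of moduli into the modulus of a single sum. *)
Lemma cmod_phase z : exists2 t : R[i], cmod t = 1 & t * z = (cmod z)%:C.
Proof.
have [->|z0] := eqVneq z 0; first by exists 1; rewrite ?cmod1 ?cmod0 ?mulr0.
have z1 : cmod z != 0 by apply: contra z0 => /eqP/cmod0_eq0 ->.
have c0 : (cmod z)%:C != 0 by rewrite fmorph_eq0.
exists ((cmod z)%:C / z); last by rewrite divfK.
by rewrite cmodM cmodV cmod_real ?cmod_ge0 // divff.
Qed.

End Modulus.

(** * Cauchy-Schwarz and Minkowski for finite families *)

Section Euclid.
Context {R : realType} {I : finType}.
Implicit Types x y : I -> R.

Definition l2 x : R := Num.sqrt (\sum_i x i ^+ 2).

Lemma l2_ge0 x : 0 <= l2 x. Proof. exact: sqrtr_ge0. Qed.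

Lemma sqr_l2 x : l2 x ^+ 2 = \sum_i x i ^+ 2.
Proof. by rewrite sqr_sqrtr // sumr_ge0 // => i _; exact: sqr_ge0. Qed.

(** Lagrange's identity: the defect is half the double sum of the squares $(x_i y_j - x_j
    y_i)^2$. *)
Lemma sum_sqr_mul x y :
  (\sum_i x i * y i) ^+ 2 <= (\sum_i x i ^+ 2) * (\sum_i y i ^+ 2).
Proof.
have : 0 <= \sum_i \sum_j (x i * y j - x j * y i) ^+ 2.
  by do 2![apply: sumr_ge0 => ? _]; exact: sqr_ge0.
have E i j : (x i * y j - x j * y i) ^+ 2 =
  x i ^+ 2 * y j ^+ 2 + y i ^+ 2 * x j ^+ 2 + (- 2 * (x i * y i)) * (x j * y j).
  by ring.
under eq_bigr => i _ do under eq_bigr => j _ do rewrite E.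
under eq_bigr => i _ do rewrite !big_split /= -!mulr_sumr.
rewrite !big_split /= -!mulr_suml -mulr_sumr expr2.
lra.
Qed.

Lemma cauchy_schwarz x y : \sum_i x i * y i <= l2 x * l2 y.
Proof.
apply: le_trans (ler_norm _) _; rewrite -sqrtr_sqr /l2 -sqrtrM.
  by rewrite ler_wsqrtr ?sum_sqr_mul.
by apply: sumr_ge0 => i _; exact: sqr_ge0.
Qed.

Lemma l2_le x y : (forall i, 0 <= x i <= y i) -> l2 x <= l2 y.
Proof.
move=> xy; apply: ler_wsqrtr; apply: ler_sum => i _.
by have /andP[x0 xy1] := xy i; rewrite lerXn2r // nnegrE // (le_trans x0).
Qed.

Lemma l2Z (a : R) x : 0 <= a -> l2 (fun i => a * x i) = a * l2 x.
Proof.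
move=> a0; rewrite /l2; under eq_bigr => i _ do rewrite exprMn.
by rewrite -mulr_sumr sqrtrM ?sqr_ge0 // sqrtr_sqr ger0_norm.
Qed.

(** Minkowski by duality: with S the total, $|S|^2 = \sum_t \langle F_t, S\rangle$; bound each term
    by Cauchy-Schwarz and divide by $|S|$. *)
Lemma l2_sum (T : Type) (r : seq T) (P : pred T) (F : T -> I -> R) :
  l2 (fun i => \sum_(t <- r | P t) F t i) <= \sum_(t <- r | P t) l2 (F t).
Proof.
set S := fun i => _; have [S0|S0] := eqVneq (l2 S) 0.
  by rewrite S0 sumr_ge0 // => t _; exact: l2_ge0.
have Sp : 0 < l2 S by rewrite lt_def S0 l2_ge0.
rewrite -(ler_pM2r Sp) -expr2 sqr_l2.
under eq_bigr => i _ do rewrite expr2 {1}/S mulr_suml.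
rewrite exchange_big /= mulr_suml; apply: ler_sum => t _.
exact: cauchy_schwarz.
Qed.

Lemma l2D x y : l2 (fun i => x i + y i) <= l2 x + l2 y.
Proof.
have := l2_sum [:: x; y] predT (fun f i => f i).
rewrite !big_cons big_nil addr0; congr (_ <= _); congr l2.
by apply: funext => i; rewrite !big_cons big_nil addr0.
Qed.

End Euclid.

(** * Means over roots of unity, Parseval and Cauchy's estimate *)

Section RootAverages.
Context {R : realType}.
Implicit Types (f g : {poly R[i]}) (L m : nat) (p : R[i] -> R).

(** The polynomial $X^L - 1$ splits and is separable, so there are L distinct roots of unity, and
    this forces one of them to be primitive. *)
Lemma prim_root_exists L : (0 < L)%N -> exists z : R[i], L.-primitive_root z.
Proof.
pose q : {poly R[i]} := 'X^L - 1; have [r Dq] := closed_field_poly_normal q.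
move=> L0; rewrite (monicP _) ?monicXnsubC // scale1r in Dq.
have rL : all L.-unity_root r by apply/allP=> z; rewrite -root_prod_XsubC -Dq.
have sz_r : (L < (size r).+1)%N.
  by rewrite -(size_prod_XsubC r id) -Dq size_XnsubC.
have [|z _ pz] := hasP (has_prim_root L0 rL _ sz_r); last by exists z.
by rewrite -separable_prod_XsubC -Dq separable_Xn_sub_1 // pnatr_eq0 -lt0n.
Qed.

Definition zeta L : R[i] := xget 0 [set z | L.-primitive_root z]%classic.

Lemma zetaP L : (0 < L)%N -> L.-primitive_root (zeta L).
Proof.
move=> L0; exact: (@xgetPex _ 0 (fun z : R[i] => L.-primitive_root z) (prim_root_exists L0)).
Qed.

Lemma cmod_zetaX L k : (0 < L)%N -> cmod (zeta L ^+ k) = 1.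
Proof.
move=> L0; rewrite cmodX; suff -> : cmod (zeta L) = 1 by rewrite expr1n.
apply/eqP; rewrite -(@eqrXn2 _ L) ?cmod_ge0 // -cmodX prim_expr_order ?zetaP //.
by rewrite cmod1 expr1n.
Qed.

Lemma cmod1_conj (z : R[i]) : cmod z = 1 -> z * conjc z = 1.
Proof. by move=> z1; rewrite -cmod_sqr z1 expr1n. Qed.

(* Orthogonality of the characters of the group of L-th roots of unity. *)
Lemma zeta_ortho L i j : (i < L)%N -> (j < L)%N ->
  \sum_(x < L) (zeta L ^+ x) ^+ i * conjc ((zeta L ^+ x) ^+ j)
    = if i == j then L%:R else 0.
Proof.
move=> iL jL; have L0 : (0 < L)%N by exact: leq_ltn_trans iL.
set z := zeta L; pose w := z ^+ i * conjc (z ^+ j).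
have zj : z ^+ j * conjc (z ^+ j) = 1 by rewrite cmod1_conj // cmod_zetaX.
have -> : \sum_(x < L) (z ^+ x) ^+ i * conjc ((z ^+ x) ^+ j) = \sum_(x < L) w ^+ x.
  by apply: eq_bigr => x _; rewrite exprMn -rmorphXn -!exprM mulnC (mulnC j).
have [ij|ij] := eqVneq i j.
  rewrite (eq_bigr (fun=> 1)) ?sumr_const ?card_ord // => x _.
  by rewrite /w ij zj expr1n.
have w1 : w - 1 != 0.
  apply: contra ij; rewrite subr_eq0 => /eqP w1.
  have : z ^+ i = z ^+ j by rewrite -[LHS]mulr1 -zj mulrCA -/w w1 mulr1.
  by move/eqP; rewrite (eq_prim_root_expr (zetaP L0)) !modn_small.
have /eqP := subrX1 w L.
rewrite [w ^+ L]exprMn -rmorphXn -!exprM mulnC (mulnC j) !exprM.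
rewrite (prim_expr_order (zetaP L0)) !expr1n rmorph1 mulr1 subrr eq_sym mulf_eq0.
by rewrite (negPf w1) => /eqP.
Qed.

Definition avg L p : R := L%:R^-1 * \sum_(x < L) p (zeta L ^+ x).

Lemma ler_avg L p q : (forall x : 'I_L, p (zeta L ^+ x) <= q (zeta L ^+ x)) ->
  avg L p <= avg L q.
Proof. by move=> pq; rewrite ler_wpM2l ?invr_ge0 ?ler0n ?ler_sum. Qed.

Lemma eq_avg L p q : (forall x : 'I_L, p (zeta L ^+ x) = q (zeta L ^+ x)) ->
  avg L p = avg L q.
Proof. by move=> pq; congr *%R; exact: eq_bigr. Qed.

Lemma avg_cst L (a : R) : (0 < L)%N -> avg L (fun=> a) = a.
Proof.
by move=> L0; rewrite /avg sumr_const card_ord -(mulr_natl a) mulKf // pnatr_eq0 -lt0n.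
Qed.

Lemma avgD L p q : avg L (fun z => p z + q z) = avg L p + avg L q.
Proof. by rewrite /avg big_split mulrDr. Qed.

Lemma avgZ L (a : R) p : avg L (fun z => a * p z) = a * avg L p.
Proof. by rewrite /avg -mulr_sumr mulrCA. Qed.

Lemma avg_sum L (I : Type) (r : seq I) (P : pred I) (F : I -> R[i] -> R) :
  avg L (fun z => \sum_(i <- r | P i) F i z) = \sum_(i <- r | P i) avg L (F i).
Proof. by rewrite /avg exchange_big mulr_sumr. Qed.

Lemma avg_exchange L M (F : R[i] -> R[i] -> R) :
  avg L (fun v => avg M (F ^~ v)) = avg M (fun u => avg L (F u)).
Proof.
rewrite /avg; under eq_bigr do rewrite mulr_sumr.
rewrite exchange_big mulr_sumr [in RHS]mulr_sumr; apply: eq_bigr => x _ /=.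
by rewrite -mulr_sumr mulrCA.
Qed.

(** All exponents lie below L, so distinct ones give distinct characters of the L-th roots of unity
    and the cross terms vanish. *)
Lemma parseval L f : (size f <= L)%N ->
  avg L (fun z => cmod f.[z] ^+ 2) = \sum_(k < L) cmod f`_k ^+ 2.
Proof.
have [->|L0 fL] := posnP L; first by rewrite /avg !big_ord0 mulr0.
have LC : (L%:R : R[i]) != 0 by rewrite pnatr_eq0 -lt0n.
apply: (@complexI R); rewrite rmorphM fmorphV rmorph_nat !rmorph_sum /=.
under eq_bigr => x _ do rewrite cmod_sqr (horner_coef_wide _ fL) rmorph_sum
  mulr_suml /=.
under eq_bigr => x _ do (under eq_bigr => j _ do rewrite mulr_sumr).
rewrite exchange_big /=.
under eq_bigr => j _ do rewrite exchange_big /=.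
rewrite mulr_sumr; apply: eq_bigr => j _.
rewrite (bigD1 j) //= [X in _ + X]big1 ?addr0 => [|k kj]; last first.
  under eq_bigr => x _ do rewrite rmorphM mulrACA.
  by rewrite -mulr_sumr zeta_ortho // eq_sym val_eqE (negPf kj) mulr0.
under eq_bigr => x _ do rewrite rmorphM mulrACA.
by rewrite -mulr_sumr zeta_ortho // eqxx mulrCA mulVf // mulr1 cmod_sqr.
Qed.

Lemma avg_cauchy_schwarz L p q :
  avg L (fun z => p z * q z) <=
  Num.sqrt (avg L (fun z => p z ^+ 2)) * Num.sqrt (avg L (fun z => q z ^+ 2)).
Proof.
have Li : 0 <= (L%:R : R)^-1 by rewrite invr_ge0 ler0n.
rewrite /avg !sqrtrM // mulrACA -expr2 sqr_sqrtr // ler_wpM2l //.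
exact: cauchy_schwarz.
Qed.

(** Cauchy's estimate without integrals: in Parseval's identity over more than k nodes, keep only
    the k-th square. *)
Lemma coef_le_sup f k (e : R) :
  (forall z, cmod z = 1 -> cmod f.[z] <= e) -> cmod f`_k <= e.
Proof.
move=> fe; have e0 : 0 <= e by apply: le_trans (cmod_ge0 _) (fe 1 _); rewrite cmod1.
pose L := maxn (size f) k.+1; have kL : (k < L)%N by rewrite leq_max ltnSn orbT.
rewrite -(@ler_pXn2r _ 2) ?nnegrE ?cmod_ge0 //.
apply: (@le_trans _ _ (\sum_(j < L) cmod f`_j ^+ 2)).
  by rewrite (bigD1 (Ordinal kL)) //= lerDl sumr_ge0 // => j _; exact: sqr_ge0.
rewrite -parseval ?leq_maxl // -(avg_cst (e ^+ 2) (leq_ltn_trans (leq0n _) kL)).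
apply: ler_avg => x; rewrite lerXn2r ?nnegrE ?cmod_ge0 // fe //.
by rewrite cmod_zetaX // (leq_ltn_trans (leq0n _) kL).
Qed.

End RootAverages.

(** * Sampling on a fixed set of nodes *)

Section Sampling.
Context {R : realType}.
Implicit Types f : {poly R[i]}.

(** For unimodular t this is $\sum_{j<M} (z/t)^j$, the analytic Dirichlet kernel translated by t. *)
Definition dirichlet M (t : R[i]) : {poly R[i]} := \poly_(j < M) conjc (t ^+ j).

Lemma avg_sqr_dirichlet L M t : cmod t = 1 -> (M <= L)%N ->
  avg L (fun z => cmod (dirichlet M t).[z] ^+ 2) = M%:R :> R.
Proof.
move=> t1 ML; rewrite parseval ?(leq_trans (size_poly _ _)) //.
rewrite (eq_bigr (fun k : 'I_L => if (k < M)%N then 1 else 0)) => [|k _].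
  by rewrite -big_mkcond -(big_ord_widen _ (fun=> 1)) // sumr_const card_ord.
rewrite coef_poly; case: ifP => _; last by rewrite cmod0 expr0n.
by rewrite cmod_conj cmodX t1 !expr1n.
Qed.

(** A kernel of de la Vallee Poussin type: its multiplier at frequency d counts the l < A with d + l
    < A + m, hence equals A for all d <= m. All exponents stay below A + m, so that many nodes
    suffice for exact orthogonality. *)
Lemma dirichlet_reproduce A m f (v : R[i]) : (0 < A)%N -> (size f <= m.+1)%N ->
  cmod v = 1 ->
  \sum_(x < A + m) f.[zeta (A + m) ^+ x] *
     ((dirichlet (A + m) (zeta (A + m) ^+ x)).[v] *
      conjc (dirichlet A (zeta (A + m) ^+ x)).[v]) = (A + m)%:R * (A%:R * f.[v]).
Proof.
move=> A0 fm v1; set M := (A + m)%N; set z := zeta M.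
pose F (d : 'I_m.+1) (l : 'I_A) (j : 'I_M) (x : 'I_M) :=
  f`_d * conjc (v ^+ l) * v ^+ j * ((z ^+ x) ^+ (d + l) * conjc ((z ^+ x) ^+ j)).
transitivity (\sum_(x < M) \sum_(d < m.+1) \sum_(l < A) \sum_(j < M) F d l j x).
  apply: eq_bigr => x _; rewrite (horner_coef_wide _ fm) mulr_suml.
  apply: eq_bigr => d _; rewrite !horner_poly rmorph_sum mulr_sumr mulr_sumr.
  apply: eq_bigr => l _; rewrite mulr_suml mulr_sumr; apply: eq_bigr => j _.
  by rewrite rmorphM /= conjcK /F exprD; ring.
rewrite exchange_big mulrCA (horner_coef_wide _ fm) !mulr_sumr /=; apply: eq_bigr => d _.
rewrite exchange_big /= (eq_bigr (fun=> f`_d * M%:R * v ^+ d)) => [|l _]; last first.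
  have dl : (d + l < M)%N by have := ltn_ord d; have := ltn_ord l; rewrite /M; lia.
  rewrite exchange_big (bigD1 (Ordinal dl)) //= [X in _ + X]big1 => [|j jdl].
    rewrite addr0 -mulr_sumr zeta_ortho // eqxx exprD.
    have /cmod1_conj ab : cmod (v ^+ l) = 1 by rewrite cmodX v1 expr1n.
    transitivity (f`_d * M%:R * v ^+ d * (v ^+ l * conjc (v ^+ l))); first by ring.
    by rewrite ab mulr1.
  rewrite -mulr_sumr zeta_ortho // eq_sym ifN ?mulr0 //.
by rewrite sumr_const card_ord -mulr_natl mulrA; ring.
Qed.

(** Makes the nodes independent of L: a mean over arbitrarily many roots is controlled by the mean
    over A + m fixed ones, with a constant that tends to 1 as A grows. *)
Lemma ler_avg_sampling A m L f : (0 < A)%N -> (size f <= m.+1)%N -> (A + m <= L)%N ->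
  avg L (fun z => cmod f.[z]) <=
  Num.sqrt ((A + m)%:R / A%:R) * avg (A + m) (fun z => cmod f.[z]) :> R.
Proof.
move=> A0 fm ML; set M := (A + m)%N.
have L0 : (0 < L)%N by lia.
have M0 : (0 < M)%N by lia.
have AR : 0 < A%:R :> R by rewrite ltr0n.
have MR : 0 < M%:R :> R by rewrite ltr0n.
set D := fun K t v => cmod (dirichlet K t).[v].
have rep v : cmod v = 1 ->
    cmod f.[v] <= A%:R^-1 * avg M (fun u => cmod f.[u] * (D M u v * D A u v)).
  move=> v1; rewrite /avg ler_pdivlMl // ler_pdivlMl //.
  have := congr1 (@cmod R) (dirichlet_reproduce A0 fm v1).
  rewrite !cmodM -!(rmorph_nat (real_complex R)) !cmod_real ?ler0n // => <-.
  apply: le_trans (ler_cmod_sum _ _ _) _.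
  by apply: ler_sum => x _; rewrite !cmodM cmod_conj.
apply: le_trans (ler_avg (q := fun v => A%:R^-1 * avg M (fun u => cmod f.[u] * (D M u v * D A u v)))
  (fun x => rep _ (cmod_zetaX x L0))) _.
rewrite avgZ avg_exchange.
rewrite mulrC ler_pdivrMr // mulrAC.
have -> : Num.sqrt (M%:R / A%:R) * A%:R = Num.sqrt M%:R * Num.sqrt A%:R :> R.
  by rewrite sqrtrM ?ler0n // sqrtrV ?ler0n // -{2}(sqr_sqrtr (ltW AR)) expr2
    mulrA mulfVK // sqrtr_eq0 -ltNge.
rewrite -avgZ; apply: ler_avg => x; rewrite avgZ mulrC ler_wpM2r ?cmod_ge0 //.
(* The two kernels have mean squares [M] and A, so their product has mean at most $\sqrt{MA}$. *)
apply: le_trans (avg_cauchy_schwarz _ _ _) _.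
by rewrite !avg_sqr_dirichlet ?cmod_zetaX //; lia.
Qed.

End Sampling.

(** * Weissler's inequality in one variable *)

Section Weissler.
Context {R : realType}.
Implicit Types (f g p q : {poly R[i]}).

(** The radius $\sqrt{p/q}$ of Weissler's contraction from $H^p$ to $H^q$, for p = 1 and q = 2. *)
Definition weight : R := Num.sqrt 2^-1.

Lemma sqr_weight : weight ^+ 2 = 2^-1.
Proof. by rewrite sqr_sqrtr // invr_ge0 ler0n. Qed.

Lemma weight_ge0 : 0 <= weight. Proof. exact: sqrtr_ge0. Qed.

Lemma weightX_le1 k : weight ^+ k <= 1.
Proof.
rewrite exprn_ile1 ?weight_ge0 // -(@ler_pXn2r _ 2) ?nnegrE ?weight_ge0 // sqr_weight expr1n.
by rewrite invf_le1 ?ler1n.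
Qed.

Definition wnorm L f : R := l2 (fun k : 'I_L => weight ^+ k * cmod f`_k).

Lemma sqr_wnorm L f : wnorm L f ^+ 2 = \sum_(k < L) 2^-1 ^+ k * cmod f`_k ^+ 2.
Proof. by rewrite sqr_l2; apply: eq_bigr => k _; rewrite exprMn -exprM mulnC exprM sqr_weight. Qed.

Lemma wnorm_widen L M f : (size f <= L)%N -> (L <= M)%N -> wnorm M f = wnorm L f.
Proof.
move=> fL LM; rewrite /wnorm /l2; congr Num.sqrt.
rewrite (big_ord_widen _ (fun k => (weight ^+ k * cmod f`_k) ^+ 2) LM) [RHS]big_mkcond.
apply: eq_bigr => k _; case: ifP => // /negbT; rewrite -leqNgt => Lk.
by rewrite nth_default ?cmod0 ?mulr0 ?expr0n // (leq_trans fL).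
Qed.

Lemma wnormD L f g : wnorm L (f + g) <= wnorm L f + wnorm L g.
Proof.
apply: le_trans (l2D _ _); apply: l2_le => k.
rewrite coefD mulr_ge0 ?exprn_ge0 ?weight_ge0 ?cmod_ge0 //= -mulrDr.
by rewrite ler_wpM2l ?exprn_ge0 ?weight_ge0 ?ler_cmodD.
Qed.

Lemma wnorm_le_sup L f (e : R) : 0 <= e -> (size f <= L)%N -> (0 < L)%N ->
  (forall z, cmod z = 1 -> cmod f.[z] <= e) -> wnorm L f <= e.
Proof.
move=> e0 fL L0 fe; rewrite -(@ler_pXn2r _ 2) ?nnegrE ?l2_ge0 // sqr_l2.
apply: (@le_trans _ _ (\sum_(k < L) cmod f`_k ^+ 2)).
  apply: ler_sum => k _; rewrite lerXn2r ?nnegrE ?cmod_ge0 //.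
    by rewrite mulr_ge0 ?exprn_ge0 ?weight_ge0 ?cmod_ge0.
  by rewrite ler_piMl ?cmod_ge0 ?weightX_le1.
rewrite -parseval // -(avg_cst (e ^+ 2) L0); apply: ler_avg => x.
by rewrite lerXn2r ?nnegrE ?cmod_ge0 // fe ?cmod_zetaX.
Qed.

(* Replacing a zero [a] of the disc by its mirror image 1 / conj a keeps the
   modulus on the circle and increases the weighted norm. *)
Lemma flip_root L p (a : R[i]) : cmod a <= 1 -> (size p < L)%N ->
  wnorm L (p * ('X - a%:P)) <= wnorm L (p * (1 - (conjc a)%:P * 'X)).
Proof.
move=> a1; case: L => [//|L]; rewrite ltnS => pL.
rewrite -(@ler_pXn2r _ 2) ?nnegrE ?l2_ge0 // !sqr_wnorm.
(* Used with u and v two consecutive coefficients of p: it gives the gain of the reflection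
   coefficient by coefficient. *)
have E (u v : R[i]) : cmod (u - conjc a * v) ^+ 2 - cmod (v - a * u) ^+ 2 =
    (1 - cmod a ^+ 2) * (cmod u ^+ 2 - cmod v ^+ 2).
  apply: (@complexI R); rewrite rmorphM !rmorphB rmorph1 /= !cmod_sqr !rmorphB !rmorphM /= conjcK.
  ring.
rewrite -subr_ge0 -sumrB.
pose c k := if k is k'.+1 then p`_k' else 0.
have cX k : (p * 'X)`_k = c k by rewrite coefMX; case: k.
have C1 k : (p * ('X - a%:P))`_k = c k - a * p`_k.
  by rewrite mulrBr coefB cX coefMC mulrC.
have C2 k : (p * (1 - (conjc a)%:P * 'X))`_k = p`_k - conjc a * c k.
  by rewrite mulrBr mulr1 coefB mulrCA coefCM cX.
have -> : \sum_(k < L.+1) (2^-1 ^+ k * cmod (p * (1 - (conjc a)%:P * 'X))`_k ^+ 2 -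
     2^-1 ^+ k * cmod (p * ('X - a%:P))`_k ^+ 2) =
   (1 - cmod a ^+ 2) * \sum_(k < L.+1) 2^-1 ^+ k * (cmod p`_k ^+ 2 - cmod (c k) ^+ 2).
  by rewrite mulr_sumr; apply: eq_bigr => k _; rewrite -mulrBr C1 C2 E mulrCA.
rewrite mulr_ge0 ?subr_ge0 ?exprn_ile1 ?cmod_ge0 //.
under eq_bigr do rewrite mulrBr.
(* Both sums run over the coefficients of p, one of them shifted by one place; the shifted one
   carries the smaller weights $2^{-(k+1)}$. *)
rewrite sumrB subr_ge0 [X in X <= _]big_ord_recl [X in _ <= X]big_ord_recr.
rewrite (_ : c ord0 = 0) // cmod0 expr0n mulr0 add0r.
rewrite [X in _ <= _ + X](_ : _ = 0) ?addr0 /c; last first.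
  by rewrite nth_default // cmod0 expr0n mulr0.
apply: ler_sum => k _; rewrite lift0 exprS ler_wpM2r ?sqr_ge0 //.
by rewrite ler_piMl ?exprn_ge0 ?invr_ge0 ?ler0n // invf_le1 ?ler1n.
Qed.

(** Parametrised by the reciprocals of the zeros: when all $|b| \le 1$, no zero lies in the open
    unit disc. *)
Definition disc_prod (s : seq R[i]) : {poly R[i]} := \prod_(b <- s) (1 - b%:P * 'X).

Lemma size_disc_prod s : (size (disc_prod s) <= (size s).+1)%N.
Proof.
elim: s => [|b s IH]; first by rewrite /disc_prod big_nil size_poly1.
rewrite /disc_prod big_cons; apply: leq_trans (size_polyMleq _ _) _.
have : (size (1 - b%:P * 'X : {poly R[i]})%R <= 2)%N.
  by rewrite mul_polyC; apply/leq_sizeP => -[|[|j]] // _;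
    rewrite coefB coefZ coefX coef1 mulr0 subrr.
by move: IH; rewrite /disc_prod /=; lia.
Qed.

Lemma cmod_reflect (r z : R[i]) : cmod z = 1 -> cmod (z - r) = cmod (1 - conjc r * z).
Proof.
move=> z1; rewrite -(cmod_conj (1 - _)) -[RHS]mul1r -z1 -cmodM.
by rewrite rmorphB rmorph1 rmorphM /= conjcK mulrBr mulr1 mulrCA cmod1_conj // mulr1.
Qed.

(** Zeros in the closed disc are reflected by [flip_root]; for the others $X - r = -r(1 - X/r)$
    already has the required shape. The factor q in the last clause lets the induction treat one
    zero while the others are carried along. *)
Lemma reflect_roots (rs : seq R[i]) : exists (c : R[i]) (s : seq R[i]),
  [/\ all (fun b => cmod b <= 1) s, (size s <= size rs)%N,
      (forall z, cmod z = 1 ->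
         cmod (\prod_(r <- rs) ('X - r%:P)).[z] = cmod (c *: disc_prod s).[z])
    & forall q L, (size q + size rs <= L)%N ->
         wnorm L (q * \prod_(r <- rs) ('X - r%:P)) <= wnorm L (q * (c *: disc_prod s))].
Proof.
elim: rs => [|r rs [c [s [s1 ss sz sw]]]].
  by exists 1, [::]; split=> //= [z _|q L _]; rewrite /disc_prod !big_nil scale1r.
have IH q L : (size q + (size rs).+1 <= L)%N ->
    wnorm L (q * (('X - r%:P) * \prod_(r <- rs) ('X - r%:P)))
     <= wnorm L (q * ('X - r%:P) * (c *: disc_prod s)).
  move=> qL; rewrite mulrA; apply: sw; have := size_polyMleq q ('X - r%:P).
  by rewrite size_XsubC; lia.
have [r1|r1] := leP (cmod r) 1.
  exists c, (conjc r :: s); split=> //=; first by rewrite cmod_conj r1.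
    move=> z z1; rewrite /disc_prod !big_cons -/(disc_prod s) scalerAr !hornerM !cmodM sz //.
    by congr (_ * _); rewrite !hornerE cmod_reflect.
  move=> q L qL; rewrite big_cons; apply: le_trans (IH _ _ qL) _.
  rewrite /disc_prod big_cons -/(disc_prod _) mulrAC scalerAr.
  rewrite [_ * (c *: _) in X in _ <= X]mulrC mulrA; apply: flip_root => //.
  apply: leq_ltn_trans (size_polyMleq _ _) _.
  rewrite (@leq_ltn_trans (size q + size s)) //; last first.
    by apply: leq_trans qL; rewrite addnS ltnS leq_add2l.
  rewrite -subn1 leq_subLR add1n -addnS leq_add2l.
  exact: leq_trans (size_scale_leq _ _) (size_disc_prod s).
have r0 : r != 0 by apply: contraTneq r1 => ->; rewrite cmod0 -leNgt ler01.
exists (- r * c), (r^-1 :: s).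
have E : ('X - r%:P) * (c *: disc_prod s) = (- r * c) *: disc_prod (r^-1 :: s).
  rewrite /disc_prod big_cons -scalerAr [- r * c]mulrC -scalerA [- r *: _]scalerAl.
  congr (c *: (_ * _)).
  by rewrite scalerBr mul_polyC scalerA mulNr mulfV // scaleN1r opprK alg_polyC polyCN addrC.
split=> //=.
- by rewrite cmodV invf_le1 ?ltW // (lt_trans ltr01).
- by move=> z z1; rewrite big_cons -E !hornerM !cmodM sz.
move=> q L qL; rewrite big_cons -E [X in _ <= wnorm _ X]mulrA; exact: IH.
Qed.

(** A fixed point x of this recursion satisfies $(1 - x)^2 = 1 - t$, so 1 minus the iterate is a
    polynomial approximation of $\sqrt{1 - t}$. The case t = 1 serves as majorant on the disc. *)
Definition sqrt_iter (t : R[i]) n : R[i] := iter n (fun x => 2^-1 * (t + x ^+ 2)) 0.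
Definition sqrt_majorant n : R := iter n (fun x => 2^-1 * (1 + x ^+ 2)) 0.

Lemma sqrt_majorant_itv n : 0 <= sqrt_majorant n <= 1.
Proof.
elim: n => [|n /andP[s0 s1]] /=; first by rewrite lexx ler01.
rewrite -/(sqrt_majorant n); apply/andP; split; nra.
Qed.

Lemma cmod_half : cmod (2^-1 : R[i]) = 2^-1.
Proof. by rewrite cmodV -(rmorph_nat (real_complex R)) cmod_real ?ler0n. Qed.

(** Majorant method: an increment is half a difference of squares, and both factors of that
    difference are dominated by those of the majorant. *)
Lemma cmod_sqrt_iter t n : cmod t <= 1 ->
  cmod (sqrt_iter t n) <= sqrt_majorant n /\
  cmod (sqrt_iter t n.+1 - sqrt_iter t n) <= sqrt_majorant n.+1 - sqrt_majorant n.
Proof.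
move=> t1; elim: n => [|n [IH1 IH2]].
  split; first by rewrite cmod0.
  have -> : sqrt_iter t 1 = 2^-1 * t by rewrite /sqrt_iter /= expr0n /= addr0.
  have -> : sqrt_majorant 1 = 2^-1 by rewrite /sqrt_majorant /= expr0n /= addr0 mulr1.
  by rewrite !subr0 cmodM cmod_half ler_piMr ?invr_ge0.
set q := sqrt_iter t; set s := sqrt_majorant.
have qS k : q k.+1 = 2^-1 * (t + q k ^+ 2) by [].
have sS k : s k.+1 = 2^-1 * (1 + s k ^+ 2) by [].
have q1 : cmod (q n.+1) <= s n.+1.
  rewrite qS sS cmodM cmod_half ler_wpM2l ?invr_ge0 //.
  apply: le_trans (ler_cmodD _ _) (lerD t1 _).
  by rewrite cmodX lerXn2r // nnegrE ?cmod_ge0 // (le_trans (cmod_ge0 _) IH1).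
split=> //; rewrite (qS n.+1) (sS n.+1) {2}(qS n) {2}(sS n).
rewrite -!mulrBr cmodM cmod_half ler_wpM2l ?invr_ge0 //.
rewrite (_ : _ - _ = (q n.+1 - q n) * (q n.+1 + q n)); last by ring.
rewrite (_ : 1 + _ - _ = (s n.+1 - s n) * (s n.+1 + s n)); last by ring.
rewrite cmodM ler_pM ?cmod_ge0 //; exact: le_trans (ler_cmodD _ _) (lerD q1 IH1).
Qed.

(** Otherwise the majorant would grow by more than e at each step, against its bound 1. A single
    small increment is all that the square root needs, so no limit is taken. *)
Lemma sqrt_majorant_step (e : R) : 0 < e ->
  exists n, sqrt_majorant n.+1 - sqrt_majorant n <= e.
Proof.
move=> e0; apply: contrapT => H.
have ge n : n%:R * e <= sqrt_majorant n.
  elim: n => [|n IH]; first by rewrite mul0r.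
  have : ~ (sqrt_majorant n.+1 - sqrt_majorant n <= e) by move=> ?; apply: H; exists n.
  by move/negP; rewrite -ltNge -natr1 mulrDl mul1r; lra.
have := ge (Num.bound e^-1); have /andP[_ le1] := sqrt_majorant_itv (Num.bound e^-1).
have e1 : 0 <= e^-1 by rewrite invr_ge0 ltW.
have := archi_boundP e1; rewrite -(ltr_pM2r e0) mulVf ?gt_eqF //.
by move=> h1 h2; have := lt_le_trans h1 (le_trans h2 le1); rewrite ltxx.
Qed.

(** For the iterate $x_n$ at t = bz one has $(1 - x_n)^2 - (1 - t) = 2(x_{n+1} - x_n)$, so a small
    increment is a small error, uniformly on the circle. *)
Lemma sqrt_disc_factor (b : R[i]) (e : R) : cmod b <= 1 -> 0 < e ->
  exists g, forall z, cmod z = 1 -> cmod (g.[z] ^+ 2 - (1 - b%:P * 'X).[z]) <= e.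
Proof.
move=> b1 e0; have e2 : 0 < e / 2 by rewrite divr_gt0.
have [n sn] := sqrt_majorant_step e2.
pose q k : {poly R[i]} := iter k (fun p => (2^-1)%:P * (b%:P * 'X + p ^+ 2)) 0.
have qE z k : (q k).[z] = sqrt_iter (b * z) k.
  elim: k => [|k IH]; first by rewrite horner0.
  by rewrite /= !hornerE IH.
exists (1 - q n) => z z1; rewrite !hornerE qE.
have bz : cmod (b * z) <= 1 by rewrite cmodM z1 mulr1.
have [_ d] := cmod_sqrt_iter n bz.
rewrite (_ : _ - _ = 2 * (sqrt_iter (b * z) n.+1 - sqrt_iter (b * z) n)).
  rewrite cmodM -(rmorph_nat (real_complex R)) cmod_real ?ler0n // mulrC.
  by rewrite -ler_pdivlMr // (le_trans d).
rewrite /= -/(sqrt_iter _ n) mulrBr mulVKf ?pnatr_eq0 //; ring.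
Qed.

Lemma sqrt_disc_prod (c : R[i]) s (e : R) : all (fun b => cmod b <= 1) s -> 0 < e ->
  exists g, forall z, cmod z = 1 -> cmod (g.[z] ^+ 2 - (c *: disc_prod s).[z]) <= e.
Proof.
elim: s e => [|b s IH] e /=.
  move=> _ e0; exists (sqrtc c)%:P => z _.
  by rewrite /disc_prod big_nil !hornerE sqr_sqrtc subrr cmod0 ltW.
case/andP=> b1 s1 e0.
have bnd z : cmod z = 1 -> cmod (c *: disc_prod s).[z] <= cmod c * 2 ^+ size s.
  move=> z1; rewrite hornerZ cmodM ler_wpM2l ?cmod_ge0 // /disc_prod.
  elim: (s) s1 => [|a s' IHs] /=; first by rewrite big_nil hornerC cmod1.
  case/andP=> a1 /IHs le; rewrite big_cons hornerM cmodM exprS ler_pM ?cmod_ge0 //.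
  rewrite !hornerE (le_trans (ler_cmodB _ _)) // cmod1 cmodM z1 mulr1.
  by rewrite (_ : 2 = 1 + 1) // lerD2l.
set B := cmod c * _ in bnd.
have B0 : 0 <= B by rewrite mulr_ge0 ?cmod_ge0 ?exprn_ge0.
have e4 : 0 < e / 4 by rewrite divr_gt0.
have d0 : 0 < B + e / 4 by rewrite ltr_wpDl.
have [g gP] := IH _ s1 e4.
(* Multiplied by $|g^2| \le B + e/4$, this tolerance costs e/2; the error e/4 of g is multiplied by
   $|1 - bz| \le 2$ and costs the other e/2. *)
have [h hP] := sqrt_disc_factor b1 (divr_gt0 (divr_gt0 e0 (ltr0n _ 2)) d0).
exists (h * g) => z z1; rewrite /disc_prod big_cons -/(disc_prod s) scalerAr !hornerM.
set v := (1 - _).[z]; set w := (c *: _).[z].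
have uv : cmod (h.[z] ^+ 2 - v) <= e / 2 / (B + e / 4) := hP z z1.
have gw : cmod (g.[z] ^+ 2 - w) <= e / 4 := gP z z1.
have v2 : cmod v <= 2.
  rewrite /v !hornerE (le_trans (ler_cmodB _ _)) // cmod1 cmodM z1 mulr1.
  by rewrite (_ : 2 = 1 + 1) // lerD2l.
have g2 : cmod (g.[z] ^+ 2) <= B + e / 4.
  rewrite -(subrK w (_ ^+ 2)) addrC (le_trans (ler_cmodD _ _)) // lerD //; exact: bnd.
rewrite (_ : _ - _ = (h.[z] ^+ 2 - v) * g.[z] ^+ 2 + v * (g.[z] ^+ 2 - w)); last by ring.
apply: le_trans (ler_cmodD _ _) _; rewrite cmodM [cmod (v * _)]cmodM.
have X : cmod (h.[z] ^+ 2 - v) * cmod (g.[z] ^+ 2) <= e / 2.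
  rewrite (le_trans (ler_pM _ _ uv g2)) ?cmod_ge0 // divfK // gt_eqF //.
have Y : cmod v * cmod (g.[z] ^+ 2 - w) <= 2 * (e / 4) by rewrite ler_pM ?cmod_ge0.
by rewrite (le_trans (lerD X Y)) //; lra.
Qed.

Lemma wnorm_sqr L g : (size g + size g <= L)%N ->
  wnorm L (g * g) <= \sum_(k < L) cmod g`_k ^+ 2.
Proof.
move=> gL; have S0 : 0 <= \sum_(k < L) cmod g`_k ^+ 2.
  by apply: sumr_ge0 => k _; rewrite exprn_ge0 ?cmod_ge0.
rewrite -(@ler_pXn2r _ 2) ?nnegrE ?l2_ge0 // sqr_wnorm.
(* Evaluating h and its square at 1 turns the sum of the Cauchy products of the $|g_j|^2$ into the
   square of their sum. *)
pose h : {poly R} := \poly_(k < size g) cmod g`_k ^+ 2.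
have hE k : h`_k = cmod g`_k ^+ 2.
  rewrite coef_poly; case: ltnP => // gk; by rewrite nth_default // cmod0 expr0n.
have -> : \sum_(k < L) cmod g`_k ^+ 2 = h.[1].
  rewrite (@horner_coef_wide _ L); last by rewrite (leq_trans (size_poly _ _)) //; lia.
  by apply: eq_bigr => k _; rewrite hE expr1n mulr1.
have hg : (size h <= size g)%N by exact: size_poly.
rewrite expr2 -hornerM (@horner_coef_wide _ L); last first.
  rewrite (leq_trans (size_polyMleq _ _)) // (leq_trans (leq_pred _)) //.
  by rewrite (leq_trans (leq_add hg hg)).
apply: ler_sum => k _; rewrite expr1n mulr1 !coefM.
under [X in _ <= X]eq_bigr do rewrite !hE -exprMn -cmodM.
set F := fun j : 'I_k.+1 => cmod (g`_j * g`_(k - j)).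
have sF : cmod (\sum_(j < k.+1) g`_j * g`_(k - j)) <= \sum_j F j * 1.
  by under [X in _ <= X]eq_bigr do rewrite mulr1; exact: ler_cmod_sum.
have := sum_sqr_mul F (fun=> 1).
rewrite expr1n sumr_const card_ord => cs.
have : cmod (\sum_(j < k.+1) g`_j * g`_(k - j)) ^+ 2 <= (\sum_j F j * 1) ^+ 2.
  by rewrite lerXn2r ?nnegrE ?cmod_ge0 // (le_trans _ sF) ?cmod_ge0.
move=> /le_trans/(_ cs) le1.
have w0 : 0 <= 2^-1 ^+ k :> R by rewrite exprn_ge0 ?invr_ge0.
apply: le_trans (ler_wpM2l w0 le1) _.
rewrite mulrCA ler_piMr //; first by apply: sumr_ge0 => j _; exact: sqr_ge0.
rewrite exprVn ler_pdivrMl ?exprn_gt0 // mulr1 -natrX ler_nat.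
exact: ltn_expl.
Qed.

Lemma weissler_1d A m f : (0 < A)%N -> (size f <= m.+1)%N ->
  wnorm m.+1 f <=
  Num.sqrt ((A + m)%:R / A%:R) * avg (A + m) (fun z => cmod f.[z]).
Proof.
move=> A0 fm; apply/ler_addgt0Pr => e e0.
have [rs Df] : exists rs : seq R[i], f = lead_coef f *: \prod_(r <- rs) ('X - r%:P).
  by have [rs] := closed_field_poly_normal f; exists rs.
have [c [s [s1 ss sz sw]]] := reflect_roots rs.
set l := lead_coef f in Df.
have d0 : 0 < e / 2 by rewrite divr_gt0.
have [g gP] := sqrt_disc_prod (l * c) s1 d0.
set f' := (l * c) *: disc_prod s in gP.
have ff' z : cmod z = 1 -> cmod f.[z] = cmod f'.[z].
  by move=> z1; rewrite Df /f' !hornerZ !cmodM sz // hornerZ cmodM mulrA.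
(* L exceeds every size in play. It depends on e through g, whereas the final mean over A + m nodes
   does not, so e can tend to 0. *)
pose L := (size g + size g + size f' + size rs + A + m + 1 +
  size (g * g)%R + size (f' - g * g)%R)%N.
have W1 : wnorm m.+1 f <= wnorm L f'.
  rewrite -(wnorm_widen fm (_ : _ <= L)%N); last by rewrite /L; lia.
  have := sw l%:P L; rewrite !mul_polyC -Df scalerA; apply.
  by rewrite (leq_trans (leq_add (size_polyC_leq1 l) (leqnn _))) // /L; lia.
have W2 : wnorm L f' <= wnorm L (g * g) + wnorm L (f' - g * g).
  by apply: le_trans (wnormD _ _ _); rewrite addrC subrK.
have W3 : wnorm L (f' - g * g) <= e / 2.
  apply: wnorm_le_sup; rewrite ?(ltW d0) //; rewrite /L; try lia.
  by move=> z /gP; rewrite -cmodN opprB !hornerE -expr2.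
have W4 : wnorm L (g * g) <= avg L (fun z => cmod g.[z] ^+ 2).
  by rewrite parseval ?wnorm_sqr //; rewrite /L; lia.
have L0 : (0 < L)%N by rewrite /L; lia.
have W5 : avg L (fun z => cmod g.[z] ^+ 2) <= avg L (fun z => cmod f.[z]) + e / 2.
  rewrite -[X in _ + X](avg_cst _ L0) -avgD; apply: ler_avg => x.
  have z1 : cmod (zeta L ^+ x : R[i]) = 1 by exact: cmod_zetaX.
  have gz := gP _ z1; rewrite ff' // -cmodX.
  have := ler_cmodD (g.[zeta L ^+ x] ^+ 2 - f'.[zeta L ^+ x]) f'.[zeta L ^+ x].
  rewrite subrK; lra.
have AL : (A + m <= L)%N by rewrite /L; lia.
have W6 := ler_avg_sampling A0 fm AL.
lra.
Qed.

End Weissler.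

(** * Weissler's inequality on the torus *)

Section SeveralVariables.
Context {R : realType}.

Definition fcons (A : finType) n (k : A) (b : {ffun 'I_n -> A}) : {ffun 'I_n.+1 -> A} :=
  [ffun i => if unlift ord0 i is Some j then b j else k].

Lemma fcons0 (A : finType) n (k : A) (b : {ffun 'I_n -> A}) : fcons k b ord0 = k.
Proof. by rewrite ffunE unlift_none. Qed.

Lemma fconsS (A : finType) n (k : A) (b : {ffun 'I_n -> A}) j :
  fcons k b (lift ord0 j) = b j.
Proof. by rewrite ffunE liftK. Qed.

Lemma sum_fcons (V : nmodType) (A : finType) n (F : {ffun 'I_n.+1 -> A} -> V) :
  \sum_f F f = \sum_k \sum_b F (fcons k b).
Proof.
rewrite pair_big /= (reindex (fun kb : A * {ffun 'I_n -> A} => fcons kb.1 kb.2)) //.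
exists (fun f : {ffun 'I_n.+1 -> A} => (f ord0, [ffun j => f (lift ord0 j)])) => [[k b] _|f _] /=.
  by rewrite fcons0; congr pair; apply/ffunP => j; rewrite ffunE fconsS.
apply/ffunP => i; case: (unliftP ord0 i) => [j|] ->; last by rewrite fcons0.
by rewrite fconsS ffunE.
Qed.

Definition vcons n (z : R[i]) (u : 'I_n -> R[i]) : 'I_n.+1 -> R[i] :=
  fun i => if unlift ord0 i is Some j then u j else z.

Lemma vcons0 n z (u : 'I_n -> R[i]) : vcons z u ord0 = z.
Proof. by rewrite /vcons unlift_none. Qed.

Lemma vconsS n z (u : 'I_n -> R[i]) j : vcons z u (lift ord0 j) = u j.
Proof. by rewrite /vcons liftK. Qed.

Fixpoint avgn L n : (('I_n -> R[i]) -> R) -> R :=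
  match n with
  | 0 => fun p => p (fun=> 0)
  | n'.+1 => fun p => avg L (fun z => avgn L (fun u => p (vcons z u)))
  end.

Lemma ler_avgn L n (p q : ('I_n -> R[i]) -> R) : (0 < L)%N ->
  (forall u, (forall i, cmod (u i) = 1) -> p u <= q u) -> avgn L p <= avgn L q.
Proof.
move=> L0; elim: n p q => [|n IH] p q pq /=; first by apply: pq; case.
apply: ler_avg => x; apply: IH => u u1; apply: pq => i.
by rewrite /vcons; case: (unlift ord0 i) => [j|]; rewrite ?u1 ?cmod_zetaX.
Qed.

Lemma eq_avgn L n (p q : ('I_n -> R[i]) -> R) : p =1 q -> avgn L p = avgn L q.
Proof. by move=> pq; congr avgn; exact: funext. Qed.

Lemma avgn_cst L n (a : R) : (0 < L)%N -> avgn L (fun=> a : R) (n := n) = a.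
Proof.
move=> L0; elim: n => [//|n IH] /=.
by rewrite (_ : (fun z => _) = fun=> a) ?avg_cst //; apply: funext.
Qed.

Lemma avgnZ L n (a : R) (p : ('I_n -> R[i]) -> R) :
  avgn L (fun u => a * p u) = a * avgn L p.
Proof.
elim: n p => [//|n IH] p /=; rewrite -avgZ; apply: eq_avg => x; exact: IH.
Qed.

Lemma avgn_sum L n (I : Type) (r : seq I) (P : pred I) (F : I -> ('I_n -> R[i]) -> R) :
  avgn L (fun u => \sum_(i <- r | P i) F i u) = \sum_(i <- r | P i) avgn L (F i).
Proof.
elim: n F => [//|n IH] F /=; rewrite -avg_sum; apply: eq_avg => x; exact: IH.
Qed.

Lemma l2_avg (I : finType) L (F : I -> R[i] -> R) :
  l2 (fun i => avg L (F i)) <= avg L (fun z => l2 (fun i => F i z)).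
Proof.
have Li : 0 <= (L%:R : R)^-1 by rewrite invr_ge0 ler0n.
rewrite l2Z // ler_wpM2l //; exact: l2_sum.
Qed.

Definition wnormn n m (c : mi n m -> R[i]) : R :=
  l2 (fun b => weight ^+ deg b * cmod (c b)).

Lemma deg_fcons n m (k : 'I_m.+1) (b : mi n m) : deg (fcons k b : mi n.+1 m) = (k + deg b)%N.
Proof. by rewrite /deg big_ord_recl fcons0; congr addn; apply: eq_bigr => j _; rewrite fconsS. Qed.

Lemma monom_fcons n m (z : R[i]) u (k : 'I_m.+1) (b : mi n m) :
  monom (vcons z u) (fcons k b : mi n.+1 m) = z ^+ k * monom u b.
Proof.
rewrite /monom big_ord_recl fcons0 vcons0; congr (_ * _).
by apply: eq_bigr => j _; rewrite fconsS vconsS.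
Qed.

(** Induction on the variables: apply the one-variable inequality in the first variable with the
    other exponents frozen, pull the mean out of the l2 norm by Minkowski, then use the induction
    hypothesis at each node. *)
Lemma weissler_several A m n (c : mi n m -> R[i]) : (0 < A)%N ->
  wnormn c <=
  Num.sqrt ((A + m)%:R / A%:R) ^+ n * avgn (A + m) (fun u => cmod (peval c u)).
Proof.
move=> A0; set kappa := Num.sqrt _; set M := (A + m)%N.
have k0 : 0 <= kappa by exact: sqrtr_ge0.
have M0 : (0 < M)%N by rewrite /M; lia.
elim: n c => [|n IH] c.
  have bE (b : mi 0 m) : b = [ffun=> ord0] by apply/ffunP => -[].
  rewrite expr0 mul1r /= /peval /wnormn /l2 !(big_pred1 [ffun=> ord0]) /=; last 2 first.
  - by move=> b; rewrite /= [b]bE eqxx.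
  - by move=> b; rewrite /= [b]bE eqxx.
  by rewrite /deg /monom !big_ord0 expr0 mul1r mulr1 sqrtr_sqr ger0_norm ?cmod_ge0.
pose P b : {poly R[i]} := \poly_(k < m.+1) c (fcons (inord k) b).
have PE b k : (P b)`_(k : 'I_m.+1) = c (fcons k b) by rewrite coef_poly ltn_ord inord_val.
have hP b z : (P b).[z] = \sum_(k < m.+1) c (fcons k b) * z ^+ k.
  by rewrite horner_poly; apply: eq_bigr => k _; rewrite inord_val.
have evE z u : peval c (vcons z u) = peval (fun b => (P b).[z]) u.
  rewrite /peval sum_fcons exchange_big; apply: eq_bigr => b _ /=.
  rewrite hP mulr_suml; apply: eq_bigr => k _.
  by rewrite monom_fcons mulrA.
have -> : wnormn c = l2 (fun b => weight ^+ deg b * wnorm m.+1 (P b)).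
  rewrite /wnormn /l2; congr Num.sqrt; rewrite sum_fcons exchange_big /=.
  apply: eq_bigr => b _; rewrite exprMn sqr_l2 mulr_sumr; apply: eq_bigr => k _.
  by rewrite PE deg_fcons -exprMn addnC exprD mulrA.
have w0 k : 0 <= weight ^+ k :> R by rewrite exprn_ge0 ?weight_ge0.
apply: (@le_trans _ _ (l2 (fun b : mi n m =>
    kappa * avg M (fun z => weight ^+ deg b * cmod (P b).[z])))).
  apply: l2_le => b; rewrite mulr_ge0 ?l2_ge0 //= avgZ mulrCA ler_wpM2l //.
  by apply: weissler_1d => //; exact: size_poly.
rewrite l2Z // exprS -mulrA ler_wpM2l //; apply: le_trans (l2_avg _ _) _.
rewrite /= -avgZ; apply: ler_avg => x; apply: le_trans (IH _) _.
by rewrite ler_wpM2l ?exprn_ge0 //; under [X in _ <= X]eq_avgn do rewrite evE.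
Qed.

End SeveralVariables.

(** * The unit ball of a lattice norm *)

Section LatticeNorm.
Context {R : realType} {n : nat} (N : ('I_n -> R[i]) -> R).
Hypothesis HN : is_lattice_norm N.
Implicit Types x y z : 'I_n -> R[i].

Lemma latticeZ (a : R[i]) z : N (fun k => a * z k) = cmod a * N z.
Proof. by have [_ h _ _] := HN. Qed.

Lemma latticeD z w : N (fun k => z k + w k) <= N z + N w.
Proof. by have [_ _ h _] := HN. Qed.

Lemma lattice_le z w : (forall k, cmod (z k) <= cmod (w k)) -> N z <= N w.
Proof. by have [_ _ _ h] := HN; exact: h. Qed.

Lemma lattice_eq z w : (forall k, cmod (z k) = cmod (w k)) -> N z = N w.
Proof. by move=> zw; apply/eqP; rewrite eq_le !lattice_le // => k; rewrite zw. Qed.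

Lemma lattice0 : N (fun=> 0) = 0.
Proof.
by have := latticeZ 0 (fun=> 0); rewrite cmod0 !mul0r.
Qed.

Lemma lattice_ge0 z : 0 <= N z.
Proof. by rewrite -lattice0; apply: lattice_le => k; rewrite cmod0 cmod_ge0. Qed.

(** Monotonicity gives $|z_k| N(e_k) \le N(z)$ for the unit vectors $e_k$. The bound is kept at
    least 1 so that its powers increase. *)
Lemma lattice_bounded : exists2 M : R, 1 <= M & forall z k, N z < 1 -> cmod (z k) <= M.
Proof.
pose e k : 'I_n -> R[i] := fun j => (j == k)%:R.
have e0 k : 0 < N (e k).
  rewrite lt_def lattice_ge0 andbT; apply/eqP; have [h _ _ _] := HN => /h /(congr1 (@^~ k)).
  by rewrite /e eqxx => /eqP; rewrite oner_eq0.
exists (1 + \sum_k (N (e k))^-1) => [|z k z1].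
  by rewrite lerDl sumr_ge0 // => k _; rewrite invr_ge0 ltW.
apply: (@le_trans _ _ (N (e k))^-1); last first.
  rewrite (bigD1 k) //= addrCA lerDl addr_ge0 ?ler01 // sumr_ge0 // => j _.
  by rewrite invr_ge0 ltW.
rewrite -[_^-1]mul1r ler_pdivlMr // -latticeZ; apply: le_trans (ltW z1).
apply: lattice_le => j; rewrite /e; case: eqP => [->|_]; first by rewrite mulr1.
by rewrite mulr0 cmod0 cmod_ge0.
Qed.

Lemma small_polydisc : exists2 r : R, 0 < r & forall z, (forall k, cmod (z k) <= r) -> N z < 1.
Proof.
have h0 := lattice_ge0 (fun=> 1); pose r := (1 + N (fun=> 1))^-1.
have r0 : 0 < r by rewrite invr_gt0; lra.
exists r => // z zr; apply: (@le_lt_trans _ _ (r * N (fun=> 1))).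
  rewrite -[X in X * _](cmod_real (ltW r0)) -latticeZ; apply: lattice_le => k.
  by rewrite mulr1 cmod_real // ltW.
by rewrite /r mulrC ltr_pdivrMr; lra.
Qed.

End LatticeNorm.

(** * Evaluation of polynomials and monomials *)

Section Polynomials.
Context {R : realType} {n m : nat}.
Implicit Types (c d : mi n m -> R[i]) (z : 'I_n -> R[i]).

Lemma pevalD c d z : peval (fun a => c a + d a) z = peval c z + peval d z.
Proof. by rewrite /peval -big_split; apply: eq_bigr => a _; rewrite mulrDl. Qed.

Lemma pevalZ (s : R[i]) c z : peval (fun a => s * c a) z = s * peval c z.
Proof. by rewrite /peval mulr_sumr; apply: eq_bigr => a _; rewrite mulrA. Qed.

Lemma peval_sum (I : Type) (r : seq I) (P : pred I) (F : I -> mi n m -> R[i]) z :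
  peval (fun a => \sum_(i <- r | P i) F i a) z = \sum_(i <- r | P i) peval (F i) z.
Proof.
rewrite /peval; under eq_bigr do rewrite mulr_suml.
by rewrite exchange_big.
Qed.

Lemma monomZ (s : R[i]) z (a : mi n m) : monom (fun k => s * z k) a = s ^+ deg a * monom z a.
Proof.
rewrite /monom; under eq_bigr do rewrite exprMn.
by rewrite big_split /= prodrXr.
Qed.

Lemma monomM z w (a : mi n m) : monom (fun k => z k * w k) a = monom z a * monom w a.
Proof. by rewrite /monom -big_split; apply: eq_bigr => k _; rewrite exprMn. Qed.

Lemma cmod_monom z (a : mi n m) : cmod (monom z a) = \prod_i cmod (z i) ^+ a i.
Proof. by rewrite cmod_prod; apply: eq_bigr => i _; rewrite cmodX. Qed.

Lemma cmod_peval_le c z : cmod (peval c z) <= \sum_a cmod (c a) * cmod (monom z a).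
Proof. by apply: le_trans (ler_cmod_sum _ _ _) _; under eq_bigr do rewrite cmodM. Qed.

Lemma monom_bound (M : R) z (a : mi n m) : 1 <= M -> (forall k, cmod (z k) <= M) ->
  cmod (monom z a) <= (M ^+ m) ^+ n.
Proof.
move=> M1 zM; rewrite cmod_monom (_ : (M ^+ m) ^+ n = \prod_(i < n) M ^+ m); last first.
  by rewrite prodr_const card_ord.
apply: ler_prod => i _; rewrite exprn_ge0 ?cmod_ge0 //=.
apply: (@le_trans _ _ (M ^+ a i)).
  by rewrite lerXn2r ?nnegrE ?cmod_ge0 ?zM // (le_trans ler01).
by rewrite ler_weXn2l // -ltnS ltn_ord.
Qed.

Lemma peval_homogeneous k c (s : R[i]) z : supported (Lambda n m k) c ->
  peval c (fun i => s * z i) = s ^+ k * peval c z.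
Proof.
move=> ck; rewrite /peval mulr_sumr; apply: eq_bigr => a _; rewrite monomZ.
have [|/ck ->] := boolP (a \in Lambda n m k); last by rewrite !mul0r mulr0.
by rewrite inE => /eqP ->; rewrite mulrCA.
Qed.

End Polynomials.

(** * The supremum norm of polynomials *)

Section PolynomialNorm.
Context {R : realType} {n m : nat} (N : ('I_n -> R[i]) -> R).
Hypothesis HN : is_lattice_norm N.
Implicit Types (c d : mi n m -> R[i]) (z : 'I_n -> R[i]).

Definition pn c : R := fine (pnorm N c).

Lemma pnorm_le c (M : R) :
  (pnorm N c <= M%:E)%E <-> (forall z, N z < 1 -> cmod (peval c z) <= M).
Proof.
split=> [le z z1|le].
  rewrite -lee_fin; apply: le_trans le; apply: ereal_sup_ubound; by exists z.
by apply: ge_ereal_sup => _ [z z1 <-]; rewrite lee_fin; exact: le.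
Qed.

(** Finite because the ball is bounded and there are finitely many monomials; from here on the norm
    is handled as a real number. *)
Lemma pnormE c : pnorm N c = (pn c)%:E.
Proof.
rewrite fineK //; have [M M1 zM] := lattice_bounded HN.
have ub : (pnorm N c <= (\sum_a cmod (c a) * (M ^+ m) ^+ n)%:E)%E.
  apply/pnorm_le => z z1; apply: le_trans (cmod_peval_le _ _) _.
  apply: ler_sum => a _; rewrite ler_wpM2l ?cmod_ge0 // monom_bound // => k.
  exact: zM.
have lb : (0%:E <= pnorm N c)%E.
  apply: le_trans (_ : ((cmod (peval c (fun=> 0)))%:E <= _)%E).
    by rewrite lee_fin cmod_ge0.
  by apply: ereal_sup_ubound; exists (fun=> 0) => //; change (N (fun=> 0) < 1); rewrite (lattice0 HN).
by rewrite fin_numElt (lt_le_trans _ lb) ?ltNyr //= (le_lt_trans ub) ?ltry.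
Qed.

Lemma le_pn c z : N z < 1 -> cmod (peval c z) <= pn c.
Proof. by move: z; apply/pnorm_le; rewrite pnormE. Qed.

Lemma pn_le c (M : R) : (forall z, N z < 1 -> cmod (peval c z) <= M) -> pn c <= M.
Proof. by move=> /pnorm_le; rewrite pnormE lee_fin. Qed.

Lemma pn_ge0 c : 0 <= pn c.
Proof. by apply: le_trans (cmod_ge0 _) (le_pn c (_ : N (fun=> 0) < 1)); rewrite (lattice0 HN). Qed.

Lemma pnD c d : pn (fun a => c a + d a) <= pn c + pn d.
Proof.
apply: pn_le => z z1; rewrite pevalD; apply: le_trans (ler_cmodD _ _) _.
by rewrite lerD ?le_pn.
Qed.

Lemma pnZ (s : R[i]) c : pn (fun a => s * c a) = cmod s * pn c.
Proof.
have le t d : pn (fun a => t * d a) <= cmod t * pn d.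
  by apply: pn_le => z z1; rewrite pevalZ cmodM ler_wpM2l ?cmod_ge0 ?le_pn.
have [->|s0] := eqVneq s 0.
  apply/eqP; rewrite eq_le le cmod0 mul0r pn_ge0 andbT //.
apply/eqP; rewrite eq_le le /=.
have sp : 0 < cmod s.
  by rewrite lt_def cmod_ge0 andbT; apply: contra s0 => /eqP/cmod0_eq0/eqP.
rewrite -ler_pdivlMl // -cmodV; apply: le_trans (le _ _).
by rewrite (_ : (fun a => _) = c) //; apply: funext => a; rewrite mulKf.
Qed.

End PolynomialNorm.

(** * Shifts of multi-indices and partial derivatives *)

Section Shift.
Context {R : realType} {n m : nat}.
Implicit Types (a b : mi n m) (c : mi n m -> R[i]).

(* Raises the i-th exponent by one; a junk value when [b i = m]. *)
Definition inc (b : mi n m) (i : 'I_n) : mi n m := [ffun j => inord (b j + (j == i))].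
Definition decr (a : mi n m) (i : 'I_n) : mi n m := [ffun j => inord (a j - (j == i))].

Lemma incE b i j : (b i < m)%N -> inc b i j = (b j + (j == i))%N :> nat.
Proof.
move=> bm; rewrite ffunE inordK //; case: eqP => [->|_]; first by rewrite addn1.
by rewrite addn0.
Qed.

Lemma decrE a i j : decr a i j = (a j - (j == i))%N :> nat.
Proof. by rewrite ffunE inordK // (leq_ltn_trans (leq_subr _ _)). Qed.

(** Substitution $a = b + e_i$, a bijection from the b with $b_i < m$ onto the a with $a_i > 0$. *)
Lemma sum_inc (V : nmodType) (F : mi n m -> V) i :
  (forall a, a i = 0%N :> nat -> F a = 0) ->
  \sum_a F a = \sum_(b : mi n m | (b i < m)%N) F (inc b i).
Proof.
move=> F0; rewrite (bigID (fun a : mi n m => (0 < a i)%N)) /= [X in _ + X]big1 ?addr0; last first.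
  by move=> a; rewrite -leqNgt leqn0 => /eqP /F0.
rewrite (reindex_onto (inc^~ i) (decr^~ i)) /=.
  apply: eq_bigl => b; have [bm|bm] := ltnP (b i) m.
    rewrite incE // eqxx addn1 /=; apply/eqP/ffunP => j; apply: val_inj => /=.
    by rewrite decrE incE // addnK.
  apply/negbTE/negP => /andP[pos /eqP/(congr1 (fun a : mi n m => nat_of_ord (a i)))].
  rewrite decrE eqxx; have := ltn_ord (inc b i i); lia.
move=> a /= a0; apply/ffunP => j; apply: val_inj => /=.
have am : (decr a i i < m)%N by rewrite decrE eqxx subn1 -ltnS prednK // ltn_ord.
by rewrite incE // decrE subnK //; case: eqP => [->|].
Qed.

Lemma deg_inc b i : (b i < m)%N -> deg (inc b i) = (deg b).+1.
Proof.
move=> bm; rewrite /deg (eq_bigr (fun j => b j + (j == i))%N) => [|j _]; last exact: incE.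
rewrite big_split /= -[RHS]addn1; congr addn.
by rewrite (bigD1 i) //= eqxx big1 // => j /negPf ->.
Qed.

Lemma plus_e_inc b i : (b i < m)%N -> plus_e b i (inc b i).
Proof. by move=> bm; apply/forallP => j; rewrite incE. Qed.

Lemma monom_inc (z : 'I_n -> R[i]) b i : (b i < m)%N -> monom z (inc b i) = z i * monom z b.
Proof.
move=> bm; rewrite /monom (bigD1 i) //= [in RHS](bigD1 i) //= incE // eqxx addn1 exprS -mulrA.
congr (_ * (_ * _)); apply: eq_bigr => j /negPf ji.
by rewrite incE // ji addn0.
Qed.

(** Coefficients of the i-th partial derivative; exponents being at most m, no monomial
    differentiates to $z^b$ when $b_i = m$. *)
Definition partial c (i : 'I_n) : mi n m -> R[i] :=
  fun b => if (b i < m)%N then (b i).+1%:R * c (inc b i) else 0.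

End Shift.

(** * Directional derivatives and Cauchy's estimate *)

Section Polarization.
Context {R : realType} {n m : nat}.
Implicit Types (c : mi n m -> R[i]) (x y : 'I_n -> R[i]).

Lemma coef1M (p q : {poly R[i]}) : (p * q)`_1 = p`_0 * q`_1 + p`_1 * q`_0.
Proof. by rewrite coefM !big_ord_recl big_ord0 addr0. Qed.

(** Leibniz' rule, the linear coefficient being the derivative at 0. *)
Lemma coef1_prod (I : eqType) (r : seq I) (p : I -> {poly R[i]}) : uniq r ->
  (\prod_(i <- r) p i)`_1 = \sum_(i <- r) (p i)`_1 * \prod_(j <- r | j != i) (p j)`_0.
Proof.
elim: r => [|k r IH] /=; first by rewrite !big_nil coef1.
case/andP=> kr /IH {}IH; rewrite !big_cons coef1M eqxx /=.
rewrite addrC IH; congr (_ * _ + _).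
  rewrite coef0_prod big_seq_cond [RHS]big_seq_cond; apply: eq_bigl => j.
  by rewrite andbT; case: (boolP (j \in r)) => //= jr; case: eqP jr kr => // -> ->.
rewrite mulr_sumr !big_seq; apply: eq_bigr => i ir.
rewrite big_cons; case: eqP ir kr => [-> ->//|_ _ _].
by rewrite mulrCA.
Qed.

Lemma coef1_exp (u v : R[i]) k :
  ((u%:P + v%:P * 'X) ^+ k)`_1 = k%:R * (v * u ^+ k.-1).
Proof.
have e0 j : ((u%:P + v%:P * 'X) ^+ j)`_0 = u ^+ j.
  by rewrite -horner_coef0 horner_exp !hornerE.
have e1 : (u%:P + v%:P * 'X)`_1 = v by rewrite coefD coefC coefCM coefX mulr1 add0r.
elim: k => [|k IH]; first by rewrite expr0 coef1 mul0r.
have e00 : (u%:P + v%:P * 'X)`_0 = u by have := e0 1%N; rewrite !expr1.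
rewrite exprS coef1M IH e1 e00 e0.
case: k {IH} => [|k]; first by rewrite mul0r mulr0 add0r mul1r.
by rewrite -[k.+2%:R]natr1 mulrDl mul1r /= exprS; ring.
Qed.

(** The polynomial on the left is $s \mapsto P(y + s x)$; its linear coefficient is the derivative
    of P at y in the direction x. *)
Lemma peval_line_coef1 c x y :
  (\sum_a c a *: \prod_i ((y i)%:P + (x i)%:P * 'X) ^+ a i)`_1 =
  \sum_i x i * peval (partial c i) y.
Proof.
rewrite coef_sum; under eq_bigr => a _ do rewrite coefZ coef1_prod ?index_enum_uniq // mulr_sumr.
rewrite exchange_big; apply: eq_bigr => i _ /=.
rewrite (sum_inc (i := i)) => [|a ->]; last by rewrite expr0 coef1 mul0r mulr0.
rewrite /peval mulr_sumr big_mkcond; apply: eq_bigr => b _.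
rewrite /partial; case: ifP => bm; last by rewrite mul0r mulr0.
rewrite coef1_exp incE // eqxx addn1 /=.
rewrite /monom (bigD1 i (F := fun k => y k ^+ _)) //=.
rewrite (eq_bigr (fun j => y j ^+ b j)) => [|j /negPf ji]; first by ring.
by rewrite -horner_coef0 horner_exp !hornerE incE // ji addn0.
Qed.

Lemma exp1Dinv_le k : (0 < k)%N -> (1 + k%:R^-1) ^+ k <= expR 1 :> R.
Proof.
move=> k0; have kR : (k%:R : R) != 0 by rewrite pnatr_eq0 -lt0n.
apply: (@le_trans _ _ (expR k%:R^-1 ^+ k)).
  by rewrite lerXn2r ?nnegrE ?expR_ge0 ?expR_ge1Dx // addr_ge0 ?ler01 ?invr_ge0 ?ler0n.
by rewrite -expRM_natl mulfV.
Qed.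

(* Cauchy's estimate for the linear coefficient of [s |-> P (y + s x)] on the circle of
   radius 1 / k; the homogeneity of P costs the factor (1 + 1 / k) ^ k <= e. *)
Lemma sum_partial_le (N : ('I_n -> R[i]) -> R) k c x y : is_lattice_norm N ->
  (0 < k)%N -> supported (Lambda n m k) c -> N x < 1 -> N y < 1 ->
  \sum_i cmod (x i) * cmod (peval (partial c i) y) <= expR 1 * k%:R * pn N c.
Proof.
move=> HN k0 ck x1 y1.
have kR : 0 < k%:R :> R by rewrite ltr0n.
set t : R := k%:R^-1; have t0 : 0 < t by rewrite invr_gt0.
have /choice[th thP] : forall i, exists u : R[i], cmod u = 1 /\
    u * (x i * peval (partial c i) y) = (cmod (x i * peval (partial c i) y))%:C.
  by move=> i; have [u] := cmod_phase (x i * peval (partial c i) y); exists u.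
(* The phases make all terms of the directional derivative nonnegative, and t = 1/k is the radius of
   Cauchy's circle. *)
pose v i := t%:C * (th i * x i).
pose Q := \sum_a c a *: \prod_i ((y i)%:P + (v i)%:P * 'X) ^+ a i.
have t1 : 0 < 1 + t by lra.
have Q1 : cmod Q`_1 <= expR 1 * pn N c.
  apply: coef_le_sup => s s1.
  (* Dividing by 1 + t brings y + s v back into the ball, since N(v) < t. *)
  have -> : Q.[s] = peval c (fun i => (1 + t)%:C * ((1 + t)^-1%:C * (y i + s * v i))).
    rewrite horner_sum; apply: eq_bigr => a _; rewrite hornerZ horner_prod; congr (_ * _).
    apply: eq_bigr => i _; rewrite horner_exp hornerD hornerM !hornerC hornerX.
    rewrite mulrA -rmorphM mulfV ?gt_eqF //.
    by rewrite rmorph1 mul1r [v i * s]mulrC.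
  rewrite (peval_homogeneous _ _ ck) cmodM cmodX cmod_real ?(ltW t1) //.
  apply: ler_pM; rewrite ?exprn_ge0 ?cmod_ge0 ?(ltW t1) ?exp1Dinv_le //.
  apply: le_pn => //; rewrite latticeZ // cmod_real ?invr_ge0 ?ltW // ltr_pdivrMl // mulr1.
  apply: le_lt_trans (latticeD HN _ _) _; rewrite ltrD //.
  rewrite (_ : N _ = t * N x) ?gtr_pMr // -[X in X * _](cmod_real (ltW t0)) -latticeZ //.
  apply: lattice_eq => // i; rewrite !cmodM s1 (thP i).1; ring.
have E : Q`_1 = (t * \sum_i cmod (x i) * cmod (peval (partial c i) y))%:C.
  rewrite peval_line_coef1 rmorphM rmorph_sum mulr_sumr; apply: eq_bigr => i _.
  by rewrite -cmodM /= -(thP i).2 /v; ring.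
move: Q1; rewrite E cmod_real; last first.
  by rewrite mulr_ge0 ?(ltW t0) // sumr_ge0 // => i _; rewrite mulr_ge0 ?cmod_ge0.
by rewrite ler_pdivrMl // mulrCA mulrA.
Qed.

End Polarization.

(** * Lipschitz bounds for monomials *)

Section Lipschitz.
Context {R : realType}.

Lemma prod_lipschitz (I : Type) (r : seq I) (x y : I -> R[i]) (B d : R) : 1 <= B ->
  (forall i, cmod (x i) <= B) -> (forall i, cmod (y i) <= B) ->
  (forall i, cmod (x i - y i) <= d) ->
  cmod (\prod_(i <- r) x i - \prod_(i <- r) y i) <= (size r)%:R * B ^+ size r * d.
Proof.
move=> B1 xB yB xyd; have B0 : 0 <= B by lra.
elim: r => [|i r IH]; first by rewrite !big_nil subrr cmod0 !mul0r.
have d0 : 0 <= d by apply: le_trans (cmod_ge0 _) (xyd i).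
rewrite !big_cons /=; set X := \prod_(_ <- _) x _ in IH *; set Y := \prod_(_ <- _) y _ in IH *.
rewrite (_ : _ - _ = x i * (X - Y) + (x i - y i) * Y); last by ring.
have Yb : cmod Y <= B ^+ size r.
  rewrite /Y cmod_prod; elim: (r) => [|j s IHs]; first by rewrite big_nil.
  by rewrite big_cons exprS ler_pM ?cmod_ge0 // -cmod_prod cmod_ge0.
apply: le_trans (ler_cmodD _ _) _; rewrite !cmodM.
apply: (@le_trans _ _ (B * ((size r)%:R * B ^+ size r * d) + d * B ^+ size r)).
  by rewrite lerD // ler_pM ?cmod_ge0.
have Bd : d * B ^+ size r <= d * B ^+ (size r).+1 by rewrite ler_wpM2l // ler_weXn2l.
have -> : B * ((size r)%:R * B ^+ size r * d) = (size r)%:R * B ^+ (size r).+1 * d.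
  by rewrite exprS; ring.
rewrite -natr1; lra.
Qed.

(** The product estimate is used twice: for each power $z_i^{a_i}$, then for the product of these n
    powers. *)
Lemma monom_lipschitz n m (z w : 'I_n -> R[i]) (a : mi n m) (B d : R) : 1 <= B -> 0 <= d ->
  (forall i, cmod (z i) <= B) -> (forall i, cmod (w i) <= B) ->
  (forall i, cmod (z i - w i) <= d) ->
  cmod (monom z a - monom w a) <= n%:R * (B ^+ m) ^+ n * (m%:R * B ^+ m) * d.
Proof.
move=> B1 d0 zB wB zw.
have B0 : 0 <= B by lra.
have powB (u : 'I_n -> R[i]) i : cmod (u i) <= B -> cmod (u i ^+ a i) <= B ^+ m.
  move=> uB; rewrite cmodX (@le_trans _ _ (B ^+ a i)) //.
    by rewrite lerXn2r ?nnegrE ?cmod_ge0.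
  by rewrite ler_weXn2l // -ltnS.
have := @prod_lipschitz _ (enum 'I_n) (fun i => z i ^+ a i) (fun i => w i ^+ a i)
  (B ^+ m) (m%:R * B ^+ m * d) (exprn_ege1 _ B1)
  (fun i => powB z i (zB i)) (fun i => powB w i (wB i)).
rewrite size_enum_ord !big_enum mulrA; apply => i.
have := @prod_lipschitz _ (iota 0 (a i)) (fun=> z i) (fun=> w i) _ _ B1 (fun=> zB i)
  (fun=> wB i) (fun=> zw i).
rewrite !big_const_seq count_predT size_iota !iter_mulr_1 => /le_trans; apply.
have am : (a i <= m)%N by rewrite -ltnS.
by rewrite ler_wpM2r // ler_pM ?exprn_ge0 ?ler0n ?ler_nat // ler_weXn2l.
Qed.

End Lipschitz.

(** * Finite norming sets in the ball *)

Section Net.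
Context {R : realType} {n m : nat} (N : ('I_n -> R[i]) -> R).
Hypothesis HN : is_lattice_norm N.
Implicit Types (c : mi n m -> R[i]) (z : 'I_n -> R[i]).

(** The ball contains a polydisc; rescaling it to the unit polydisc and applying [weissler_several]
    bounds every coefficient. Only the independence of C from the polynomial matters. *)
Lemma coef_bound : exists2 C : R, 0 <= C & forall c b, cmod (c b) <= C * pn N c.
Proof.
have [r r0 rP] := small_polydisc HN.
pose kappa : R := Num.sqrt ((1 + m)%:R / 1%:R) ^+ n.
have k0 : 0 <= kappa by rewrite exprn_ge0 ?sqrtr_ge0.
have wr0 : 0 < weight * r by rewrite mulr_gt0 // sqrtr_gt0 invr_gt0.
exists (\sum_(b : mi n m) kappa / (weight * r) ^+ deg b) => [|c b].
  by rewrite sumr_ge0 // => b _; rewrite divr_ge0 ?exprn_ge0 ?ltW.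
apply: (@le_trans _ _ (kappa / (weight * r) ^+ deg b * pn N c)); last first.
  rewrite ler_wpM2r ?pn_ge0 // (bigD1 b) //= lerDl sumr_ge0 // => a _.
  by rewrite divr_ge0 ?exprn_ge0 ?(ltW wr0).
rewrite mulrAC ler_pdivlMr ?exprn_gt0 // mulrC.
pose d b := r%:C ^+ deg b * c b.
have -> : (weight * r) ^+ deg b * cmod (c b) = weight ^+ deg b * cmod (d b).
  by rewrite /d cmodM cmodX cmod_real ?(ltW r0) // exprMn mulrA.
have le_l2 : weight ^+ deg b * cmod (d b) <= wnormn d.
  rewrite /wnormn /l2 -[X in X <= _]ger0_norm; last first.
    by rewrite mulr_ge0 ?cmod_ge0 ?exprn_ge0 ?weight_ge0.
  rewrite -sqrtr_sqr ler_wsqrtr // (bigD1 b) //= lerDl sumr_ge0 // => a _; exact: sqr_ge0.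
apply: le_trans le_l2 _; apply: le_trans (weissler_several d (ltn0Sn 0)) _.
rewrite ler_wpM2l // -[X in _ <= X](@avgn_cst _ (1 + m) n) //; apply: ler_avgn => // u u1.
rewrite (_ : peval d u = peval c (fun k => r%:C * u k)).
  by apply: le_pn => //; apply: rP => k; rewrite cmodM u1 mulr1 cmod_real ?(ltW r0).
by apply: eq_bigr => a _; rewrite monomZ /d; ring.
Qed.

(** Cut the real and imaginary parts of the coordinates into cells and pick a point of the ball in
    each cell that meets it; the remaining cells receive the origin. *)
Lemma ball_net (d : R) : 0 < d -> exists (T : finType) (pt : T -> 'I_n -> R[i]),
  (forall t, N (pt t) < 1) /\
  (forall z, N z < 1 -> exists t, forall i, cmod (z i - pt t i) <= d).
Proof.
move=> d0; have [M M1 zM] := lattice_bounded HN.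
(* Cells have side d/2, so the real and imaginary errors add up to at most d. *)
pose G : R := 2 / d; have G0 : 0 < G by rewrite divr_gt0.
pose S := Num.truncn (G * (M + M)).
pose cell (x : R) : 'I_S.+1 := inord (Num.truncn (G * (x + M))).
pose cells (z : 'I_n -> R[i]) : {ffun 'I_n -> 'I_S.+1 * 'I_S.+1} :=
  [ffun i => (cell (complex.Re (z i)), cell (complex.Im (z i)))].
have cellP x y : `|x| <= M -> `|y| <= M -> cell x = cell y -> `|x - y| <= d / 2.
  have aux u : `|u| <= M -> [/\ 0 <= G * (u + M), (Num.truncn (G * (u + M)) < S.+1)%N &
     (Num.truncn (G * (u + M)))%:R <= G * (u + M) < (Num.truncn (G * (u + M))).+1%:R].
    rewrite ler_norml => /andP[u1 u2].
    have p0 : 0 <= G * (u + M) by rewrite mulr_ge0 ?(ltW G0) //; lra.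
    split=> //; last by rewrite truncn_itv.
    by rewrite ltnS /S le_truncn // ler_wpM2l ?(ltW G0) // lerD2r.
  move=> /aux[_ xS /andP[x1 x2]] /aux[_ yS /andP[y1 y2]] /(congr1 val) /=.
  rewrite !inordK // => exy; rewrite exy -natr1 in x1 x2; rewrite -natr1 in y2.
  have : `|G * (x - y)| <= 1 by rewrite ler_norml; apply/andP; split; lra.
  rewrite normrM gtr0_norm // /G mulrAC ler_pdivrMr // mul1r; lra.
pose pt t : 'I_n -> R[i] :=
  if pselect (exists z, N z < 1 /\ cells z = t) is left h then projT1 (cid h) else fun=> 0.
exists {ffun 'I_n -> 'I_S.+1 * 'I_S.+1}, pt; split=> [t|z z1].
  rewrite /pt; case: pselect => [h|_]; last by rewrite (lattice0 HN).
  by case: (cid h) => w [].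
exists (cells z) => i; rewrite /pt; case: pselect => [h|[]]; last by exists z.
case: (cid h) => w [w1 /= wz].
have := congr1 (fun f : {ffun _} => f i) wz; rewrite !ffunE => -[/esym e1 /esym e2].
have := zM z i z1; have := zM w i w1.
case: (z i) (w i) e1 e2 => [a b] [a' b'] e1 e2 wM zM'.
have reim (u v : R) : cmod (u +i* v) <= M -> `|u| <= M /\ `|v| <= M.
  move=> uv; split; apply: le_trans uv; rewrite /cmod -sqrtr_sqr ler_wsqrtr //.
    by rewrite lerDl sqr_ge0.
  by rewrite lerDr sqr_ge0.
have [aM bM] := reim _ _ zM'; have [a'M b'M] := reim _ _ wM.
have ha := cellP _ _ aM a'M e1; have hb := cellP _ _ bM b'M e2.
rewrite [X in cmod X]complexE.
apply: le_trans (ler_cmodD _ _) _; rewrite cmodM.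
have cr (u : R) : cmod u%:C = `|u| by rewrite /cmod /= expr0n addr0 sqrtr_sqr.
have -> : cmod ('i : R[i]) = 1 by rewrite /cmod /= expr0n add0r expr1n sqrtr1.
rewrite !cr mul1r; apply: le_trans (lerD ha hb) _; lra.
Qed.

(** Passing to the nearest net point changes the value by at most $E d \|P\|$, with $E d \le 1 -
    1/K$ by the choice of the mesh d; this error is absorbed into the left-hand side. *)
Lemma norming_net (K : R) : 1 < K -> exists (T : finType) (pt : T -> 'I_n -> R[i]),
  (forall t, N (pt t) < 1) /\
  (forall c M, (forall t, cmod (peval c (pt t)) <= M) -> pn N c <= K * M).
Proof.
move=> K1; have [C C0 cC] := coef_bound; have [B B1 zB] := lattice_bounded HN.
pose D : R := n%:R * (B ^+ m) ^+ n * (m%:R * B ^+ m).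
have D0 : 0 <= D.
  have B0 : 0 <= B by lra.
  by rewrite /D; do ![apply: mulr_ge0]; rewrite ?ler0n // !exprn_ge0.
pose E := #|{: mi n m}|%:R * C * D; have E0 : 0 <= E.
  by rewrite /E; do 2![apply: mulr_ge0 => //]; exact: ler0n.
have E1 : 0 < E + 1 by lra.
have Kp : 0 < K by lra.
pose eta := 1 - K^-1; have eta0 : 0 < eta by rewrite subr_gt0 invf_lt1.
have [T [pt [pt1 ptz]]] := ball_net (divr_gt0 eta0 E1).
exists T, pt; split=> // c M cM; set d := eta / (E + 1) in ptz.
have d0 : 0 < d by rewrite divr_gt0.
have Ed : E * d <= eta.
  by rewrite /d mulrCA ger_pMr // ler_pdivrMr // mul1r lerDl.
have p0 := pn_ge0 HN c.
have le : pn N c <= M + E * d * pn N c.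
  apply: pn_le => // z z1; have [t tz] := ptz z z1.
  rewrite -(subrK (peval c (pt t)) (peval c z)) addrC (le_trans (ler_cmodD _ _)) // lerD //.
  rewrite /peval -sumrB; apply: le_trans (ler_cmod_sum _ _ _) _.
  rewrite [X in _ <= X](_ : _ = \sum_(a : mi n m) (C * pn N c) * (D * d)); last first.
    by rewrite sumr_const -[RHS]mulr_natl /E; ring.
  apply: ler_sum => a _; rewrite -mulrBr cmodM ler_pM ?cmod_ge0 //.
  by apply: monom_lipschitz => // [|i|i]; rewrite ?(ltW d0) //; exact: zB.
have le2 : pn N c <= M + eta * pn N c.
  by apply: le_trans le _; rewrite lerD2l ler_wpM2r.
have : K^-1 * pn N c <= M by move: le2; rewrite /eta; lra.
by rewrite ler_pdivrMl.
Qed.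

End Net.

(** * A projection read off from samples *)

Section Projection.
Context {R : realType} {n m : nat} (N : ('I_n -> R[i]) -> R).
Hypothesis HN : is_lattice_norm N.
Variables (I : {set mi n m}) (T : finType) (pt : T -> 'I_n -> R[i]) (K : R).
Hypothesis K1 : 1 < K.
Hypothesis ptN : forall t, N (pt t) < 1.
Hypothesis ptK : forall (c : mi n m -> R[i]) M,
  (forall t, cmod (peval c (pt t)) <= M) -> pn N c <= K * M.
Implicit Types (c : mi n m -> R[i]).

Local Notation Z := {ffun T -> R[i]^o}.

Definition samples c : Z := [ffun t => peval c (pt t)].

(** The costs of all splittings of x into samples of a polynomial and a remainder; their infimum is
    an infimal convolution of the two norms. *)
Definition netset (x : Z) : set R := [set v | exists c M,
  [/\ supported I c, 0 <= M, (forall t, cmod (x t - peval c (pt t)) <= M)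
    & v = pn N c + K * M]]%classic.

(* The supremum norm over the net, perturbed so that sampling is exactly isometric on
   the polynomials supported by I; it lies between the supremum norm and K times it. *)
Definition netnorm (x : Z) : R := inf (netset x).

Let K0 : 0 <= K. Proof. by rewrite ltW // (lt_trans ltr01). Qed.

Lemma peval0 z : peval (fun _ : mi n m => 0 : R[i]) z = 0.
Proof. by rewrite /peval big1 // => a _; rewrite mul0r. Qed.

Lemma pn0 : pn N (fun _ : mi n m => 0) = 0.
Proof.
apply/eqP; rewrite eq_le pn_ge0 // andbT; apply: pn_le => // z _.
by rewrite peval0 cmod0.
Qed.

Lemma netnorm_le (x : Z) c (M : R) : supported I c -> 0 <= M ->
  (forall t, cmod (x t - peval c (pt t)) <= M) -> netnorm x <= pn N c + K * M.
Proof.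
move=> cI M0 xM; apply: ge_inf; last by exists c, M.
exists 0 => _ [c' [M' [_ M'0 _ ->]]]; by rewrite addr_ge0 ?pn_ge0 ?mulr_ge0.
Qed.

Lemma le_netnorm (x : Z) (v : R) : (forall c (M : R), supported I c -> 0 <= M ->
    (forall t, cmod (x t - peval c (pt t)) <= M) -> v <= pn N c + K * M) ->
  v <= netnorm x.
Proof.
move=> h; apply: lb_le_inf => [|_ [c [M [cI M0 xM ->]]]]; last exact: h.
pose M := \sum_t cmod (x t); exists (pn N (fun _ : mi n m => 0) + K * M), (fun=> 0), M; split=> //.
  by rewrite sumr_ge0 // => t _; exact: cmod_ge0.
move=> t; rewrite peval0 subr0 /M (bigD1 t) //= lerDl sumr_ge0 // => s _.
exact: cmod_ge0.
Qed.

Lemma netnorm_sup (x : Z) (M : R) : 0 <= M -> (forall t, cmod (x t) <= M) -> netnorm x <= K * M.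
Proof.
move=> M0 xM; rewrite -[X in _ <= X]add0r -pn0; apply: netnorm_le => // t.
by rewrite peval0 subr0.
Qed.

(** For the lower bound write c = c' + (c - c'): the samples of c - c' are at most M, so its norm is
    at most K M because the net is norming. *)
Lemma netnorm_samples c : supported I c -> netnorm (samples c) = pn N c.
Proof.
move=> cI; apply/eqP; rewrite eq_le; apply/andP; split.
  rewrite -[X in _ <= X]addr0 -(mulr0 K); apply: netnorm_le => // t.
  by rewrite ffunE subrr cmod0.
apply: le_netnorm => c' M _ M0 cM.
have -> : c = fun a => c' a + (c a + (-1) * c' a) by apply: funext => a; ring.
apply: le_trans (pnD HN _ _) _; rewrite lerD2l; apply: ptK => t.
by rewrite pevalD pevalZ mulN1r; have := cM t; rewrite ffunE.
Qed.

Lemma netnorm_norm : is_norm netnorm.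
Proof.
have scale (a : R[i]) x : netnorm (a *: x) <= cmod a * netnorm x.
  have [->|a0] := eqVneq a 0.
    rewrite scale0r cmod0 mul0r -(mulr0 K); apply: netnorm_sup => // t.
    by rewrite ffunE cmod0.
  have ap : 0 < cmod a.
    by rewrite lt_def cmod_ge0 andbT; apply: contra a0 => /eqP/cmod0_eq0/eqP.
  rewrite -ler_pdivrMl //; apply: le_netnorm => c M cI M0 xM.
  rewrite ler_pdivrMl // mulrDr -pnZ // mulrCA; apply: netnorm_le.
  - by move=> b /cI ->; rewrite mulr0.
  - by rewrite mulr_ge0 ?cmod_ge0.
  by move=> t; rewrite ffunE pevalZ -mulrBr cmodM ler_wpM2l ?cmod_ge0.
split=> [x x0|a x|x y].
- apply/ffunP => t; rewrite ffunE; apply: cmod0_eq0.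
  apply/eqP; rewrite eq_le cmod_ge0 andbT -x0; apply: le_netnorm => c M cI M0 xM.
  rewrite -(subrK (peval c (pt t)) (x t)) addrC (le_trans (ler_cmodD _ _)) // lerD ?le_pn //.
  by rewrite (le_trans (xM t)) // ler_peMl // ltW.
- apply/eqP; rewrite eq_le scale /=.
  have [->|a0] := eqVneq a 0.
    rewrite cmod0 mul0r; apply: le_netnorm => c M _ M0 _.
    by rewrite addr_ge0 ?pn_ge0 ?mulr_ge0.
  have ap : 0 < cmod a.
    by rewrite lt_def cmod_ge0 andbT; apply: contra a0 => /eqP/cmod0_eq0/eqP.
  by rewrite -ler_pdivlMl // -cmodV -{1}(scalerK a0 x).
rewrite -lerBlDr; apply: le_netnorm => c M cI M0 xM.
rewrite lerBlDr [X in _ <= X]addrC -lerBlDr; apply: le_netnorm => d L dI L0 yL.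
rewrite lerBlDr [X in _ <= X](_ : _ = (pn N c + pn N d) + K * (M + L)); last by ring.
apply: (@le_trans _ _ (pn N (fun a => c a + d a) + K * (M + L))); last by rewrite lerD2r pnD.
apply: netnorm_le => [a aI||t]; first by rewrite cI // dI // addr0.
  by rewrite addr_ge0.
rewrite ffunE pevalD opprD addrACA; apply: le_trans (ler_cmodD _ _) _.
by rewrite lerD.
Qed.

Lemma rel_proj_const_le : (rel_proj_const N I netnorm samples <= proj_const N I)%E.
Proof.
apply: ereal_sup_ubound; exists Z, netnorm, samples; split=> //.
- exact: netnorm_norm.
- by move=> s c d _ _; apply/ffunP => t; rewrite !ffunE pevalD pevalZ.
- by move=> c cI; rewrite netnorm_samples // pnormE.
Qed.

(** The strict inequality yields a projection of norm below l; [Pi t] is its value at the t-th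
    coordinate vector, and the second clause says that it fixes the polynomials supported by I. *)
Lemma projection_matrix (l : R) : (proj_const N I < l%:E)%E ->
  exists Pi : T -> mi n m -> R[i],
  [/\ (forall t, supported I (Pi t)),
      (forall c, supported I c -> forall b, c b = \sum_t peval c (pt t) * Pi t b)
    & (forall th : T -> R[i], (forall t, cmod (th t) <= 1) ->
         pn N (fun b => \sum_t th t * Pi t b) <= K * l)].
Proof.
move=> /(le_lt_trans rel_proj_const_le) /ereal_inf_lt[_ [P [Plin Psupp Pid ->]] Pl].
have P0 a : P 0 a = 0.
  have := Plin 1 0 0 a; rewrite scaler0 addr0 mul1r => /eqP.
  by rewrite -subr_eq0 opprD addNKr oppr_eq0 => /eqP.
pose delta t : Z := [ffun s => (s == t)%:R].
have Psum x b : P x b = \sum_t x t * P (delta t) b.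
  have {1}-> : x = \sum_t x t *: delta t.
    have dE s t : (x t *: delta t) s = x t * (s == t)%:R by rewrite 2!ffunE.
    apply/ffunP => s; rewrite sum_ffunE.
    under eq_bigr do rewrite dE.
    rewrite (bigD1 s) //= eqxx mulr1 big1 ?addr0 // => t ts.
    by rewrite eq_sym (negPf ts) mulr0.
  elim: (index_enum T) => [|t r IH]; first by rewrite !big_nil P0.
  by rewrite !big_cons Plin IH.
exists (fun t => P (delta t)); split=> [t|c cI b|th th1]; first exact: Psupp.
  by rewrite -{1}(Pid c cI) Psum; apply: eq_bigr => t _; rewrite ffunE.
have Kp : 0 < K by rewrite (lt_trans ltr01).
(* The perturbed norm is at most K times the supremum norm, so dividing by K lands in its unit
   ball. *)
pose x : Z := [ffun t => K^-1%:C * th t].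
have nx : netnorm x <= 1.
  rewrite -(mulfV (lt0r_neq0 Kp)); apply: netnorm_sup; first by rewrite invr_ge0 ltW.
  move=> t; rewrite ffunE cmodM cmod_real ?invr_ge0 ?(ltW Kp) // ler_piMr //.
  by rewrite invr_ge0 ltW.
have : (pnorm N (P x) <= l%:E)%E.
  by apply: le_trans (ltW Pl); apply: ereal_sup_ubound; exists x.
rewrite pnormE // lee_fin -ler_pdivrMl // => le.
rewrite (_ : (fun b => _) = fun b => K%:C * P x b).
  by rewrite pnZ // cmod_real // mulrA mulVf ?gt_eqF // mul1r.
apply: funext => b; rewrite Psum mulr_sumr; apply: eq_bigr => t _.
by rewrite ffunE !mulrA -rmorphM mulfV ?gt_eqF // rmorph1 mul1r.
Qed.

End Projection.

(** * The homogeneous estimate *)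

Section Homogeneous.
Context {R : realType} {n m : nat} (N : ('I_n -> R[i]) -> R).
Hypothesis HN : is_lattice_norm N.
Implicit Types (c : mi n m -> R[i]) (I J : {set mi n m}).

Definition unit_coef (b : mi n m) : mi n m -> R[i] := fun a => (a == b)%:R.

Lemma unit_coef_supported I b : b \in I -> supported I (unit_coef b).
Proof.
move=> bI a; apply: contraNeq; rewrite /unit_coef.
by case: (a =P b) => [->|_]; rewrite ?eqxx.
Qed.

Lemma peval_unit_coef b z : peval (unit_coef b) z = monom z b.
Proof.
rewrite /peval (bigD1 b) //= /unit_coef eqxx mul1r big1 ?addr0 // => a /negPf ->.
by rewrite mul0r.
Qed.

Lemma pn_unit_coef_gt0 b : 0 < pn N (unit_coef b).
Proof.
have [C C0 cC] := coef_bound (m := m) HN; rewrite lt_def pn_ge0 // andbT.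
apply/eqP => p0; have := cC (unit_coef b) b.
by rewrite p0 mulr0 /unit_coef eqxx cmod1 ler10.
Qed.

Definition normalized (b : mi n m) : mi n m -> R[i] :=
  fun a => (pn N (unit_coef b))^-1%:C * unit_coef b a.

Lemma pn_normalized b : pn N (normalized b) = 1.
Proof.
have p0 := pn_unit_coef_gt0 b.
by rewrite pnZ // cmod_real ?invr_ge0 ?(ltW p0) // mulVf // gt_eqF.
Qed.

Lemma normalized_supported I b : b \in I -> supported I (normalized b).
Proof. by move=> /unit_coef_supported bI a /bI; rewrite /normalized => ->; rewrite mulr0. Qed.

(** A projection fixes c, so its norm is at least $\|c\| = e \le 1$. The net embedding with K = 2
    serves as test space. *)
Lemma proj_const_ge I (e : R) : 0 <= e ->
  (exists2 c, supported I c & pn N c = e) -> e <= 1 -> (e%:E <= proj_const N I)%E.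
Proof.
move=> e0 [c cI ce] e1.
have [T [pt [ptN ptK]]] := norming_net (m := m) HN (ltr1n R 2).
apply: le_trans (rel_proj_const_le HN I (ltr1n R 2) ptN ptK).
apply: le_ereal_inf_tmp => _ [P [_ _ Pid ->]].
apply: ereal_sup_ubound; exists (samples pt c).
  by rewrite /= netnorm_samples // ?ltr1n // ce.
by rewrite Pid // pnormE // ce.
Qed.

Lemma proj_const_ge0 I : (0 <= proj_const N I)%E.
Proof. by apply: proj_const_ge => //; exists (fun=> 0) => //; exact: pn0. Qed.

Lemma proj_const_ge1 I b : b \in I -> (1 <= proj_const N I)%E.
Proof.
move=> bI; apply: proj_const_ge => //; exists (normalized b); last exact: pn_normalized.
exact: normalized_supported.
Qed.

Lemma Qnorm_ge I' I c : supported I' c -> pn N c <= 1 ->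
  ((pn N (Qproj I c))%:E <= Qnorm N I' I)%E.
Proof.
move=> cI c1; rewrite -pnormE //; apply: ereal_sup_ubound; exists c => //.
by split=> //; rewrite pnormE // lee_fin.
Qed.

Lemma Qnorm_ge0 I' I : (0 <= Qnorm N I' I)%E.
Proof.
apply: le_trans (Qnorm_ge I (c := fun=> 0) _ _) => //; last by rewrite pn0.
by rewrite lee_fin pn_ge0.
Qed.

Lemma Qnorm_ge1 I' I b : b \in I -> I \subset I' -> (1 <= Qnorm N I' I)%E.
Proof.
move=> bI /fintype.subsetP II'; rewrite -(pn_normalized b).
have bI' : supported I' (normalized b) by exact: normalized_supported (II' _ bI).
rewrite (_ : pn N _ = pn N (Qproj I (normalized b))).
  by apply: Qnorm_ge => //; rewrite pn_normalized.
congr pn; apply: funext => a; rewrite /Qproj; case: ifP => // /negbT.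
exact: normalized_supported.
Qed.

(** The k-th part of P at z is the k-th coefficient of $s \mapsto P(sz)$, to which Cauchy's estimate
    applies. *)
Lemma pn_homogeneous_part k c : pn N (Qproj (Lambda n m k) c) <= pn N c.
Proof.
apply: pn_le => // z z1.
pose Q := \sum_a (c a * monom z a) *: 'X^(deg a).
have -> : peval (Qproj (Lambda n m k) c) z = Q`_k.
  rewrite coef_sum; apply: eq_bigr => a _; rewrite coefZ coefXn /Qproj inE eq_sym.
  by case: eqP => _; rewrite ?mulr1 ?mul0r ?mulr0.
apply: coef_le_sup => s s1.
have -> : Q.[s] = peval c (fun i => s * z i).
  rewrite horner_sum; apply: eq_bigr => a _.
  by rewrite hornerZ hornerXn monomZ -mulrA [monom z a * _]mulrC.
by apply: le_pn => //; rewrite latticeZ // s1 mul1r.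
Qed.

Lemma flat_inc k I (b : mi n m) i : (0 < k)%N -> I \subset Lambda n m k -> (b i < m)%N ->
  inc b i \in I -> b \in flat k I.
Proof.
move=> k0 /fintype.subsetP Ik bm bI; rewrite inE; apply/andP; split.
  by have := Ik _ bI; rewrite inE deg_inc // => /eqP <-.
by apply/existsP; exists (inc b i); rewrite bI; apply/existsP; exists i; exact: plus_e_inc.
Qed.

Lemma flat_neq0 k I (a : mi n m) : (0 < k)%N -> I \subset Lambda n m k -> a \in I ->
  exists b, b \in flat k I.
Proof.
move=> k0 Ik aI; have := fintype.subsetP Ik _ aI; rewrite inE => /eqP ak.
have [i ai] : exists i, (0 < a i)%N.
  apply/existsP; apply: contraLR k0; rewrite negb_exists => /forallP a0.
  rewrite -ak /deg big1 // => i _; apply/eqP; rewrite -leqn0 leqNgt; exact: a0.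
have am : (decr a i i < m)%N by rewrite decrE eqxx subn1 -ltnS prednK // ltn_ord.
exists (decr a i); apply: (flat_inc (i := i) k0 Ik am).
rewrite (_ : inc _ _ = a) //; apply/ffunP => j; apply: val_inj => /=.
by rewrite incE // decrE subnK //; case: eqP => [->|].
Qed.

(** Euler's identity for one variable, taken with moduli; summing over i will produce the degree. *)
Lemma sum_partial c z : forall i,
  cmod (z i) * \sum_b cmod (partial c i b) * cmod (monom z b) =
  \sum_(a : mi n m) (a i)%:R * (cmod (c a) * cmod (monom z a)).
Proof.
move=> i; rewrite [RHS](sum_inc (i := i)) => [|a ->]; last by rewrite mul0r.
rewrite mulr_sumr [RHS]big_mkcond; apply: eq_bigr => b _.
rewrite /partial; case: ifP => bm; last by rewrite cmod0 mul0r mulr0.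
rewrite incE // eqxx addn1 monom_inc // !cmodM -(rmorph_nat (real_complex R)).
by rewrite cmod_real ?ler0n //; ring.
Qed.

(** With A = 5nm + 1, $(1 + m/A)^n \le e^{nm/A} \le e^{1/5} \le 5/4$, the last because $e^{-1/5} \ge
    4/5$. *)
Lemma sampling_constant : exists2 A, (0 < A)%N &
  (Num.sqrt ((A + m)%:R / A%:R) ^+ n) ^+ 2 <= 5 / 4 :> R.
Proof.
pose A := (5 * n * m).+1; exists A => //.
have AR : 0 < A%:R :> R by rewrite ltr0n.
rewrite -exprM mulnC exprM sqr_sqrtr ?divr_ge0 ?ler0n // natrD mulrDl divff ?gt_eqF //.
set x := m%:R / A%:R; have x0 : 0 <= x by rewrite divr_ge0 ?ler0n.
have nx : n%:R * x <= 1 / 5.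
  rewrite /x mulrA ler_pdivrMr // [X in _ <= _ * X](_ : _ = 5 * n%:R * m%:R + 1); last first.
    by rewrite /A -addn1 natrD !natrM.
  by lra.
apply: (@le_trans _ _ (expR x ^+ n)).
  by rewrite lerXn2r ?nnegrE ?expR_ge0 ?expR_ge1Dx ?addr_ge0.
rewrite -expRM_natl -[X in expR X]opprK expRN.
have := expR_ge1Dx (- (n%:R * x)) => e1.
have e2 : 4 / 5 <= expR (- (n%:R * x)) by lra.
by rewrite -[5 / 4](invf_div) lef_pV2 // posrE ?expR_gt0 // divr_gt0.
Qed.

(** The losses are 5/4 from the net, 5/4 from approaching the projection constant and 5/4 from the
    two uses of Weissler's inequality together. Since $(5/4)^3 = 125/64 < 2$, they turn $2^{k-1}$
    into at most $2^k$. *)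
Lemma sum_le_pn_homogeneous k I c (lam : R) z : (0 < k)%N -> I \subset Lambda n m k ->
  supported I c -> 0 < lam -> (proj_const N (flat k I) <= lam%:E)%E -> N z < 1 ->
  \sum_a cmod (c a) * cmod (monom z a) <= expR 1 * 2 ^+ k * lam * pn N c.
Proof.
move=> k0 Ik cI lam0 plam z1.
have K1 : 1 < 5 / 4 :> R by lra.
have [T [pt [ptN ptK]]] := norming_net (m := m) HN K1.
have lt : (proj_const N (flat k I) < (5 / 4 * lam)%:E)%E.
  by apply: le_lt_trans plam _; rewrite lte_fin; lra.
have [Pi [PiI Prep Pnorm]] := projection_matrix HN K1 ptN ptK lt.
have [A A0 kap] := sampling_constant; set kappa := Num.sqrt _ ^+ n in kap.
have kap0 : 0 <= kappa by rewrite exprn_ge0 ?sqrtr_ge0.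
set M := (A + m)%N; have M0 : (0 < M)%N by rewrite /M; lia.
have kR : 0 < k%:R :> R by rewrite ltr0n.
have ck : supported (Lambda n m k) c 
  by move=> a ak; apply: cI; apply: contra ak => /(fintype.subsetP Ik).
have dsupp i b : b \notin flat k I -> partial c i b = 0.
  rewrite /partial; case: ifP => // bm; apply: contraNeq => nz.
  apply: (flat_inc (i := i)) => //; apply: contraNT nz => /cI ->; by rewrite mulr0.
(* The b-th coefficient of the reproduced monomial $z^b$ is 1; this is the identity to be
   inserted. *)
have one b : b \in flat k I -> 1 <= \sum_t cmod (monom (pt t) b) * cmod (Pi t b).
  move=> bI; have := Prep _ (unit_coef_supported bI) b; rewrite /unit_coef eqxx => one.
  rewrite -[X in X <= _](cmod1 (R := R)) [X in cmod X <= _](one : 1 = _).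
  apply: le_trans (ler_cmod_sum _ _ _) _.
  by apply: ler_sum => t _; rewrite cmodM peval_unit_coef.
pose dt t i b := partial c i b * monom (pt t) b.
pose pz t b := Pi t b * monom z b.
have step1 i : \sum_b cmod (partial c i b) * cmod (monom z b) <=
    \sum_t \sum_b cmod (dt t i b) * cmod (pz t b).
  rewrite exchange_big; apply: ler_sum => b _ /=.
  have [bI|/dsupp ->] := boolP (b \in flat k I); last first.
    by rewrite cmod0 mul0r sumr_ge0 // => t _; rewrite mulr_ge0 ?cmod_ge0.
  rewrite (_ : \sum_t _ = cmod (partial c i b) * cmod (monom z b) *
     \sum_t cmod (monom (pt t) b) * cmod (Pi t b)).
    by rewrite ler_peMr ?one // mulr_ge0 ?cmod_ge0.
  by rewrite mulr_sumr; apply: eq_bigr => t _; rewrite !cmodM; ring.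
pose al t i := avgn M (fun u => cmod (peval (partial c i) (fun j => pt t j * u j))).
pose be t := avgn M (fun u => cmod (peval (Pi t) (fun j => z j * u j))).
have be0 t : 0 <= be t.
  by rewrite -(avgn_cst n (0 : R) M0); apply: ler_avgn => // u _; exact: cmod_ge0.
(* Every b in the flat has degree k - 1, so the two weights multiply to $2^{-(k-1)}$ exactly. *)
have step2 t i : \sum_b cmod (dt t i b) * cmod (pz t b) <=
    2 ^+ k.-1 * kappa ^+ 2 * (al t i * be t).
  rewrite (_ : \sum_b _ = 2 ^+ k.-1 * \sum_b (weight ^+ deg b * cmod (dt t i b)) *
      (weight ^+ deg b * cmod (pz t b))).
    rewrite -mulrA ler_wpM2l ?exprn_ge0 //.
    apply: le_trans (cauchy_schwarz _ _) _.
    have h1 : wnormn (dt t i) <= kappa * al t i.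
      apply: le_trans (weissler_several _ A0) _; rewrite ler_wpM2l //.
      rewrite (_ : (fun u => _) = fun u => cmod (peval (partial c i) (fun j => pt t j * u j))) //.
      apply: funext => u; congr cmod; apply: eq_bigr => b _; rewrite monomM /dt; ring.
    have h2 : wnormn (pz t) <= kappa * be t.
      apply: le_trans (weissler_several _ A0) _; rewrite ler_wpM2l //.
      rewrite (_ : (fun u => _) = fun u => cmod (peval (Pi t) (fun j => z j * u j))) //.
      apply: funext => u; congr cmod; apply: eq_bigr => b _; rewrite monomM /pz; ring.
    apply: le_trans (ler_pM (l2_ge0 _) (l2_ge0 _) h1 h2) _.
    by rewrite le_eqVlt; apply/orP; left; apply/eqP; ring.
  rewrite mulr_sumr; apply: eq_bigr => b _.
  have [bI|/dsupp d0] := boolP (b \in flat k I); last by rewrite /dt d0 mul0r cmod0 !(mul0r, mulr0).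
  have -> : deg b = k.-1 by move: bI; rewrite inE => /andP[/eqP].
  have w : 2 ^+ k.-1 * (weight ^+ k.-1 * weight ^+ k.-1) = 1 :> R.
    by rewrite -exprMn -exprMn -expr2 sqr_weight mulfV ?pnatr_eq0 // expr1n.
  rewrite -[LHS]mul1r -[in LHS]w; ring.
(* The modulus of the torus variable u is 1, so pt t and its product with u have the same lattice
   norm and Cauchy's estimate applies pointwise in u. *)
have step3 t : \sum_i cmod (z i) * al t i <= expR 1 * k%:R * pn N c.
  under eq_bigr do rewrite -avgnZ.
  rewrite -avgn_sum -[X in _ <= X](avgn_cst n _ M0); apply: ler_avgn => // u u1.
  apply: sum_partial_le => //; rewrite (lattice_eq HN (w := pt t)) //.
  by move=> j; rewrite cmodM u1 mulr1.
(* For fixed u, phases align the values of the [Pi t]; the norm bound for unimodular combinations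
   then controls the sum of moduli. *)
have step4 : \sum_t be t <= 5 / 4 * (5 / 4 * lam).
  rewrite -avgn_sum -[X in _ <= X](avgn_cst n _ M0); apply: ler_avgn => // u u1.
  pose w j := z j * u j.
  have /choice[th thP] : forall t, exists s : R[i], cmod s = 1 /\
      s * peval (Pi t) w = (cmod (peval (Pi t) w))%:C.
    by move=> t; have [s] := cmod_phase (peval (Pi t) w); exists s.
  have th1 t : cmod (th t) <= 1 by rewrite (thP t).1.
  apply: le_trans (Pnorm th th1).
  apply: le_trans (le_pn HN _ (_ : N w < 1)); last first.
    by rewrite (lattice_eq HN (w := z)) // => j; rewrite cmodM u1 mulr1.
  rewrite peval_sum; under [X in _ <= cmod X]eq_bigr do rewrite pevalZ (thP _).2.
  rewrite -rmorph_sum cmod_real // sumr_ge0 // => t _; exact: cmod_ge0.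
have deg_sum : k%:R * \sum_a cmod (c a) * cmod (monom z a) =
    \sum_i cmod (z i) * \sum_b cmod (partial c i b) * cmod (monom z b).
  under [RHS]eq_bigr do rewrite sum_partial.
  rewrite exchange_big mulr_sumr; apply: eq_bigr => a _ /=.
  rewrite -mulr_suml -natr_sum; have [/ck ->|] := boolP (a \notin Lambda n m k).
    by rewrite cmod0 mul0r !mulr0.
  by rewrite negbK inE => /eqP <-.
have p0 := pn_ge0 HN c.
rewrite -(ler_pM2l kR) deg_sum.
apply: (@le_trans _ _ (\sum_i cmod (z i) *
    \sum_t 2 ^+ k.-1 * kappa ^+ 2 * (al t i * be t))).
  apply: ler_sum => i _; rewrite ler_wpM2l ?cmod_ge0 //; apply: le_trans (step1 i) _.
  by apply: ler_sum => t _; exact: step2.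
rewrite (_ : \sum_i _ = 2 ^+ k.-1 * kappa ^+ 2 *
    \sum_t (\sum_i cmod (z i) * al t i) * be t); last first.
  rewrite mulr_sumr; under eq_bigr do rewrite mulr_sumr.
  rewrite exchange_big; apply: eq_bigr => t _; rewrite mulr_suml mulr_sumr.
  by apply: eq_bigr => i _; ring.
have w0 : 0 <= 2 ^+ k.-1 :> R by rewrite exprn_ge0.
apply: (@le_trans _ _ (2 ^+ k.-1 * kappa ^+ 2 *
    (expR 1 * k%:R * pn N c * (5 / 4 * (5 / 4 * lam))))).
  rewrite ler_wpM2l ?mulr_ge0 ?sqr_ge0 //.
  apply: (@le_trans _ _ (\sum_t expR 1 * k%:R * pn N c * be t)).
    by apply: ler_sum => t _; rewrite ler_wpM2r.
  by rewrite -mulr_sumr ler_wpM2l // !mulr_ge0 ?expR_ge0 ?ler0n.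
have -> : 2 ^+ k = 2 * 2 ^+ k.-1 :> R by rewrite -exprS prednK.
set X := 2 ^+ k.-1 in w0 *.
have Y0 : 0 <= X * (expR 1 * k%:R * pn N c) * lam.
  by rewrite !mulr_ge0 ?expR_ge0 ?ler0n // ltW.
rewrite [X in X <= _](_ : _ = (kappa ^+ 2 * (25 / 16)) * (X * (expR 1 * k%:R * pn N c) * lam));
  last by field.
rewrite [X in _ <= X](_ : _ = 2 * (X * (expR 1 * k%:R * pn N c) * lam)); last by ring.
by rewrite ler_wpM2r //; lra.
Qed.

End Homogeneous.

(** * From absolute sums to the unconditional basis constant *)

Section Unconditional.
Context {R : realType} {n m : nat} (N : ('I_n -> R[i]) -> R).
Hypothesis HN : is_lattice_norm N.
Implicit Types (c : mi n m -> R[i]) (J : {set mi n m}).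

(** The sum of the moduli of the terms dominates every choice of unimodular factors at once. *)
Lemma chi_mon_le J (B : R) : 0 <= B ->
  (forall c z, supported J c -> N z < 1 ->
     \sum_a cmod (c a) * cmod (monom z a) <= B * pn N c) ->
  (chi_mon N J <= B%:E)%E.
Proof.
move=> B0 cB; apply: ereal_inf_lbound; exists B => //; split=> // c cJ eps eps1.
rewrite !pnormE // -EFinM lee_fin; apply: pn_le => // z z1.
apply: le_trans (cmod_peval_le _ _) _; apply: le_trans (cB c z cJ z1).
by apply: ler_sum => a _; rewrite cmodM eps1 mul1r.
Qed.

Lemma chi_mon_set0_le (x : \bar R) : (0 <= x)%E -> (chi_mon N (finset.set0 : {set mi n m}) <= x)%E.
Proof.
apply: le_trans; apply: chi_mon_le => // c z c0 _.
rewrite mul0r big1 // => a _; by rewrite c0 ?inE // cmod0 mul0r.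
Qed.

(* The constant term costs a factor one, and each of the other homogeneous parts is
   controlled by the homogeneous case: this gives m + 1 summands. *)
Lemma sum_le_pn J c (lam : R) z : (forall a, a \in J -> (deg a <= m)%N) -> 1 <= lam ->
  (forall k, (1 <= k <= m)%N -> (proj_const N (flat k (Jk J k)) <= lam%:E)%E) ->
  supported J c -> N z < 1 ->
  \sum_a cmod (c a) * cmod (monom z a) <= expR 1 * m.+1%:R * 2 ^+ m * lam * pn N c.
Proof.
move=> Jm lam1 plam cJ z1; set B := expR 1 * 2 ^+ m * lam.
have lam0 : 0 < lam by lra.
have p0 := pn_ge0 HN c.
pose ck k := Qproj (Lambda n m k) c.
have -> : \sum_a cmod (c a) * cmod (monom z a) =
    \sum_(k < m.+1) \sum_a cmod (ck k a) * cmod (monom z a).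
  rewrite exchange_big; apply: eq_bigr => a _ /=.
  rewrite -mulr_suml; congr (_ * _).
  have [aJ|aJ] := boolP (a \in J); last first.
    by rewrite cJ // cmod0 big1 // => k _; rewrite /ck /Qproj cJ // if_same cmod0.
  have am : (deg a < m.+1)%N by rewrite ltnS Jm.
  rewrite (bigD1 (Ordinal am)) //= /ck /Qproj inE eqxx big1 ?addr0 // => k.
  by rewrite inE -val_eqE eq_sym => /negPf ->; rewrite cmod0.
have Bk k : (k < m.+1)%N -> \sum_a cmod (ck k a) * cmod (monom z a) <= B * pn N c.
  move=> km; have pk : pn N (ck k) <= pn N c := pn_homogeneous_part HN k c.
  have [->|k0] := posnP k.
    pose a0 : mi n m := [ffun=> ord0].
    have ck0 a : a != a0 -> ck 0%N a = 0.
      move=> aa0; rewrite /ck /Qproj inE; case: ifP => //.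
      rewrite /deg sum_nat_eq0 => /fintype.forallP az; case/eqP: aa0.
      by apply/ffunP => i; apply: val_inj; rewrite ffunE; apply/eqP; exact: az.
    (* The constant term has no flat to estimate it; [lam] being at least 1 lets the common bound
       cover it. *)
    have B1 : 1 <= B.
      have e1 : 1 <= expR 1 :> R by apply: le_trans (expR_ge1Dx _); rewrite lerDl.
      have e2 : 1 <= 2 ^+ m :> R by rewrite exprn_ege1 ?ler1n.
      by rewrite /B !mulr_ege1.
    rewrite (bigD1 a0) //= big1 => [|a /ck0 ->]; last by rewrite cmod0 mul0r.
    have ev : peval (ck 0%N) z = ck 0%N a0 * monom z a0.
      by rewrite /peval (bigD1 a0) //= big1 ?addr0 // => a /ck0 ->; rewrite mul0r.
    rewrite addr0 -cmodM -ev.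
    apply: le_trans (le_pn HN _ z1) _; apply: le_trans (pn_homogeneous_part HN 0 c) _.
    by rewrite ler_peMl.
  have ckJ : supported (Jk J k) (ck k).
    move=> a; rewrite /Jk /ck /Qproj inE; case: ifP => //; rewrite andbT => _; exact: cJ.
  have kk : (1 <= k <= m)%N by rewrite k0 -ltnS.
  apply: le_trans (sum_le_pn_homogeneous HN k0 (subsetIr _ _) ckJ lam0 (plam k kk) z1) _.
  apply: ler_pM => //; rewrite ?pn_ge0 // ?mulr_ge0 ?expR_ge0 ?exprn_ge0 ?(ltW lam0) //.
  rewrite /B ler_wpM2r ?(ltW lam0) // ler_wpM2l ?expR_ge0 // ler_weXn2l ?ler1n //.
apply: (@le_trans _ _ (\sum_(k < m.+1) B * pn N c)); first by apply: ler_sum => k _; exact: Bk.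
rewrite sumr_const card_ord -[X in X <= _]mulr_natl /B le_eqVlt; apply/orP; left.
by apply/eqP; ring.
Qed.

(** Inserts the norm y of the coefficient projection, a factor at least 1, and reduces to a finite
    projection constant z, since for $z = +\infty$ the bound is trivial. *)
Lemma ereal_bound_le (x y z : \bar R) (C : R) : 0 < C -> (1 <= y)%E -> (1 <= z)%E ->
  (forall l : R, z = l%:E -> (x <= (C * l)%:E)%E) -> (x <= C%:E * (y * z))%E.
Proof.
move=> C0 y1 z1 h; apply: (@le_trans _ _ (C%:E * z)%E).
  case: z z1 h => [l _ h| _ _ |//]; first by rewrite -EFinM; exact: h.
  by rewrite gt0_muley ?lte_fin // leey.
apply: lee_wpmul2l; first by rewrite lee_fin ltW.
by rewrite lee_pemull // (le_trans _ z1).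
Qed.

End Unconditional.

(** For J = {0} every J(k) with k >= 1 is empty and both maxima vanish, whereas the unconditional
    constant is 1; for m = 0 the maxima range over no index. Hence the two side conditions. *)
Theorem theorem2p7 (R : realType) (n m : nat)
  (N : ('I_n -> R[i]) -> R) (J : {set mi n m}) :
  is_lattice_norm N ->
  (forall a, a \in J -> (deg a <= m)%N) ->
  (1 <= m)%N ->
  J != [set [ffun => (ord0 : 'I_m.+1)]] ->
  (chi_mon N J <=
     (expR 1 * m.+1%:R * 2 ^+ m)%:E *
     ((\big[maxe/-oo]_(1 <= k < m.+1) Qnorm N (Lambda n m k) (Jk J k)) *
      (\big[maxe/-oo]_(1 <= k < m.+1) proj_const N (flat k (Jk J k)))))%E
  /\
  (J \subset Lambda n m m ->
   (chi_mon N J <=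
      (expR 1 * 2 ^+ m)%:E *
      (Qnorm N (Lambda n m m) J * proj_const N (flat m J)))%E).
Proof.
move=> HN Jm m0 J0.
have e2 (k : nat) : 0 < expR 1 * 2 ^+ k :> R by rewrite mulr_gt0 ?expR_gt0 ?exprn_gt0.
have maxk (F : nat -> \bar R) k : (1 <= k <= m)%N -> (F k <= \big[maxe/-oo]_(1 <= i < m.+1) F i)%E.
  by case/andP=> k1 km; apply: le_bigmax_seq => //; rewrite mem_index_iota k1 ltnS.
(* For empty J the left side is at most 0, so only the sign of the right side matters. *)
have [->|[a aJ]] := set_0Vmem J.
  have chi0 := chi_mon_set0_le HN.
  split=> [|_]; apply: chi0; rewrite mule_ge0 ?lee_fin ?mulr_ge0 ?expR_ge0 ?exprn_ge0 ?ler0n //.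
    rewrite mule_ge0 //.
      by apply: le_trans (maxk _ 1%N _); rewrite ?m0 // Qnorm_ge0.
    by apply: le_trans (maxk _ 1%N _); rewrite ?m0 // proj_const_ge0.
  by rewrite mule_ge0 ?Qnorm_ge0 ?proj_const_ge0.
split=> [|JL].
  (* An index of positive degree makes both maxima at least 1, witnessed at k = deg b. *)
  have [b bJ b0] : exists2 b, b \in J & (0 < deg b)%N.
    apply: contrapT => H; case/eqP: J0; apply/setP => b; rewrite finset.in_set1.
    have Jd b' : b' \in J -> b' = [ffun=> ord0].
      move=> b'J; have : ~~ (0 < deg b')%N by apply/negP => d; apply: H; exists b'.
      rewrite -eqn0Ngt /deg sum_nat_eq0 => /fintype.forallP az; apply/ffunP => i; apply: val_inj.
      by rewrite ffunE; apply/eqP; exact: az.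
    apply/idP/eqP => [/Jd //|->]; by rewrite -(Jd _ aJ).
  have bm := Jm _ bJ; have bk : b \in Jk J (deg b) by rewrite !inE bJ eqxx.
  have kk : (1 <= deg b <= m)%N by rewrite b0.
  apply: ereal_bound_le => [|||l lE].
  - by rewrite !mulr_gt0 ?expR_gt0 ?exprn_gt0 ?ltr0n.
  - apply: le_trans (maxk _ _ kk); exact: Qnorm_ge1 bk (subsetIr _ _).
  - apply: le_trans (maxk _ _ kk).
    have [d dF] := flat_neq0 b0 (subsetIr _ _) bk; exact: proj_const_ge1 dF.
  have l1 : 1 <= l.
    rewrite -lee_fin -lE; apply: le_trans (maxk _ _ kk).
    have [d dF] := flat_neq0 b0 (subsetIr _ _) bk; exact: proj_const_ge1 dF.
  apply: chi_mon_le => // [|c z cJ z1].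
    by rewrite !mulr_ge0 ?expR_ge0 ?exprn_ge0 ?ler0n // (le_trans ler01).
  by apply: (sum_le_pn HN Jm l1) => // k km; rewrite -lE maxk.
have [d dF] := flat_neq0 m0 JL aJ.
apply: ereal_bound_le => [|||l lE].
- exact: e2.
- exact: Qnorm_ge1 aJ JL.
- exact: proj_const_ge1 dF.
have l0 : 0 < l.
  by rewrite -lte_fin -lE; apply: lt_le_trans (proj_const_ge1 HN dF).
apply: chi_mon_le => // [|c z cJ z1]; first by rewrite mulr_ge0 // ltW.
by apply: (sum_le_pn_homogeneous HN m0 JL cJ l0) => //; rewrite lE.
Qed.
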